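(* For odd $k$ and $n=2^{k-1}-1$, let $G_n^b$ be the graph whose $n$ vertices are the vectors in $\mathbb{F}_2^k$ having an odd number of ones, except the vector of all ones, with distinct vertices $u,v$ adjacent if and only if $\langle u,v\rangle=1$ (inner product computed over the binary field $\mathbb{F}_2$). The following hold. (i) There exists an absolute constant $C_4'$ such that $$\max_{s\le\frac12\log_2 n-C_4'\log\log n}\ \max_{H_s\in\mathcal{G}(s)}\left|\frac{n_{G_n^b}(H_s)}{\mathbb{E}\bigl(n_{G(n,\frac12)}(H_s)\bigr)}-1\right|\to0\quad\text{as }n\to\infty.$$ (ii) Let $I_s$ denote the empty graph with vertex set $[s]$. Then for any $\eta>0$, $$\max_{s\le(1-\eta)\log_2 n}\left|\frac{n_{G_n^b}(I_s)}{\mathbb{E}\bigl(n_{G(n,\frac12)}(I_s)\bigr)}-1\right|\to0\quad\text{as }n\to\infty.$$ Moreover, the size of the largest independent set in $G_n^b$ is $\log_2(n+1)+1$. (iii) Let $C_s$ denote the complete graph with vertex set $[s]$. Then for any $\eta>0$, setting $\bar s:=(\frac12+\eta)\log_2 n$, $$\frac{n_{G_n^b}(C_{\bar s})}{\mathbb{E}\bigl(n_{G(n,\frac12)}(C_{\bar s})\bigr)}\ge\exp(-2/3)\,2^{\binom{\eta\log_2 n}{2}}$$ for all large $n$.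
   Context: $n\to\infty$ is along the values $n=2^{k-1}-1$, $k$ odd. $[s]=\{1,\dots,s\}$; $\mathcal{G}(s)$ is the set of all graphs with vertex set $[s]$ ($s$ a positive integer). For graphs $G,H$, $n_G(H)$ is the number of induced isomorphic copies of $H$ in $G$ (number of vertex subsets of $G$ inducing a subgraph isomorphic to $H$). $G(n,\frac12)$ is the Erdős–Rényi random graph on $[n]$ with edge probability $\frac12$, so $\mathbb{E}(n_{G(n,\frac12)}(H_s))=\frac{(n)_s}{|\mathrm{Aut}(H_s)|}2^{-\binom s2}$ with $(n)_s=n(n-1)\cdots(n-s+1)$. $\log$ is the natural logarithm, $\binom{x}{2}=x(x-1)/2$, and $\bar s$ is understood as an integer (integer parts are suppressed). *)

(* Defs.v *)
From HB Require Import structures.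
From mathcomp Require Import all_boot all_order all_algebra.
From mathcomp Require Import all_classical all_reals all_analysis.
Set Implicit Arguments.
Unset Strict Implicit.
Unset Printing Implicit Defensive.
Import Order.TTheory GRing.Theory Num.Theory.
Local Open Scope ring_scope.

Definition sgraph_axiom (T : finType) (e : {ffun T * T -> bool}) : bool :=
  [forall x, ~~ e (x, x)] && [forall x, forall y, e (x, y) == e (y, x)].

Record sgraph (T : finType) :=
  SGraph { edges :> {ffun T * T -> bool}; edgesP : sgraph_axiom edges }.

HB.instance Definition _ (T : finType) := [isSub for @edges T].
HB.instance Definition _ (T : finType) := [Finite of sgraph T by <:].

Definition adj (T : finType) (G : sgraph T) : rel T :=
  fun x y => edges G (x, y).

Lemma sgraph_axiom_finfun (T : finType) (e : rel T) :
  irreflexive e -> symmetric e ->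
  sgraph_axiom [ffun p : T * T => e p.1 p.2].
Proof.
move=> eirr esym; apply/andP; split.
  by apply/forallP => x; rewrite ffunE /= eirr.
by apply/forallP => x; apply/forallP => y; rewrite !ffunE /= esym.
Qed.

Definition mk_sgraph (T : finType) (e : rel T)
    (eirr : irreflexive e) (esym : symmetric e) : sgraph T :=
  SGraph (sgraph_axiom_finfun eirr esym).

Lemma adj_mk_sgraph (T : finType) (e : rel T)
    (eirr : irreflexive e) (esym : symmetric e) x y :
  adj (mk_sgraph eirr esym) x y = e x y.
Proof. by rewrite /adj /= ffunE. Qed.

Lemma adj_irr (T : finType) (G : sgraph T) : irreflexive (adj G).
Proof.
by move=> x; apply: negbTE; have /andP[/forallP/(_ x)] := edgesP G.
Qed.

Lemma adj_sym (T : finType) (G : sgraph T) : symmetric (adj G).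
Proof.
move=> x y; apply/eqP.
by have /andP[_ /forallP/(_ x)/forallP/(_ y)] := edgesP G.
Qed.

Section Induced.
Variables (T : finType) (G : sgraph T) (U : {set T}).

Definition induced_adj : rel {x : T | x \in U} :=
  fun x y => adj G (val x) (val y).

Lemma induced_adj_irr : irreflexive induced_adj.
Proof. by move=> x; apply: adj_irr. Qed.

Lemma induced_adj_sym : symmetric induced_adj.
Proof. by move=> x y; apply: adj_sym. Qed.

Definition induced : sgraph {x : T | x \in U} :=
  mk_sgraph induced_adj_irr induced_adj_sym.
End Induced.

Definition isomorphic (T U : finType) (G : sgraph T) (H : sgraph U) : bool :=
  [exists f : {ffun T -> U},
    [&& injectiveb f, [forall y, y \in codom f]
      & [forall x, forall y, adj H (f x) (f y) == adj G x y]]].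

(* n_G(H) *)
Definition induced_copies (T U : finType) (G : sgraph T) (H : sgraph U) : nat :=
  #|[pred A : {set T} | isomorphic (induced G A) H]|.

Definition independent (T : finType) (G : sgraph T) (A : {set T}) : bool :=
  [forall x in A, forall y in A, ~~ adj G x y].

Definition independence_number (T : finType) (G : sgraph T) : nat :=
  \max_(A : {set T} | independent G A) #|A|.

Lemma empty_adj_irr (T : finType) : irreflexive (fun _ _ : T => false).
Proof. by []. Qed.

Lemma empty_adj_sym (T : finType) : symmetric (fun _ _ : T => false).
Proof. by []. Qed.

Definition empty_graph (s : nat) : sgraph 'I_s :=
  mk_sgraph (@empty_adj_irr 'I_s) (@empty_adj_sym 'I_s).

Lemma complete_adj_irr (T : finType) : irreflexive (fun x y : T => x != y).
Proof. by move=> x; rewrite eqxx. Qed.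

Lemma complete_adj_sym (T : finType) : symmetric (fun x y : T => x != y).
Proof. by move=> x y; rewrite eq_sym. Qed.

Definition complete_graph (s : nat) : sgraph 'I_s :=
  mk_sgraph (@complete_adj_irr 'I_s) (@complete_adj_sym 'I_s).

(* The law of the Erdos-Renyi graph G(n, p), as a mass function. *)
Definition er_mass (R : realType) (n : nat) (p : R) (G : sgraph 'I_n) : R :=
  \prod_(u : 'I_n) \prod_(v : 'I_n | (u < v)%N)
    (if adj G u v then p else 1 - p).

Definition er_expectation (R : realType) (n : nat) (p : R)
    (X : sgraph 'I_n -> R) : R :=
  \sum_(G : sgraph 'I_n) er_mass p G * X G.

Section OddVectorGraph.
Variable k : nat.

Definition inner (u v : 'rV['F_2]_k) : 'F_2 := \sum_(i < k) u 0 i * v 0 i.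

Definition odd_vertex : finType :=
  {v : 'rV['F_2]_k | odd #|[pred i | v 0 i == 1]| && (v != const_mx 1)}.

Definition odd_adj : rel odd_vertex :=
  fun u v => (u != v) && (inner (val u) (val v) == 1).

Lemma odd_adj_irr : irreflexive odd_adj.
Proof. by move=> u; rewrite /odd_adj eqxx. Qed.

Lemma odd_adj_sym : symmetric odd_adj.
Proof.
move=> u v; rewrite /odd_adj eq_sym; congr (_ && (_ == _)).
by apply: eq_bigr => i _; rewrite mulrC.
Qed.

(* G_n^b, with n = 2^(k-1) - 1 *)
Definition odd_vector_graph : sgraph odd_vertex :=
  mk_sgraph odd_adj_irr odd_adj_sym.

Definition order_of : nat := (2 ^ (k - 1) - 1)%N.
End OddVectorGraph.

Definition copies_ratio (R : realType) (k s : nat) (H : sgraph 'I_s) : R :=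
  (induced_copies (odd_vector_graph k) H)%:R /
  er_expectation (2^-1 : R)
    (fun G : sgraph 'I_(order_of k) => (induced_copies G H)%:R).

Definition log2 (R : realType) (x : R) : R := ln x / ln 2.

Definition binom2 (R : realType) (x : R) : R := x * (x - 1) / 2.

(* Maximum over the integers s >= 1 with s <= x; it is 0 when there are none. *)
Definition max_upto (R : realType) (x : R) (F : nat -> R) : R :=
  \big[Num.max/0]_(1 <= s < (Num.truncn x).+1) F s.

(* k tends to infinity through the odd integers *)
Definition odd_oo : set_system nat := within [set k : nat | odd k]%classic \oo%classic.

#[global] Instance odd_oo_filter : ProperFilter odd_oo.
Proof.
apply: (@Build_ProperFilter_ex _ _ _ (within_filter _ _)).
move=> P [N _ NP]; exists N.*2.+1.
apply: NP; rewrite /= ?odd_double //.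
by rewrite -addnn -addnS leq_addr.
Qed.

(* Main.v *)
Require Import Defs.
From mathcomp Require Import all_boot all_order all_algebra mxabelem.
From mathcomp Require Import all_classical all_reals all_analysis.
From mathcomp Require Import zify ring lra.
Set Implicit Arguments.
Unset Strict Implicit.
Unset Printing Implicit Defensive.
Import Order.TTheory GRing.Theory Num.Theory.
Import numFieldNormedType.Exports.
Local Open Scope ring_scope.

(** Write [k = 2m + 1] and [N = n + 1 = 2 ^ (k - 1)], and let [1] be the all-ones
    vector.  An odd vector [u] satisfies [<u, u> = <u, 1> = 1], so an embedding of a
    graph [H] on [s] vertices into the odd vector graph is an [s] by [k] matrix [U]
    over F_2 whose Gram matrix [U U^T] is prescribed (1 on the diagonal, the
    adjacencies of [H] elsewhere) and whose rows are distinct and different from [1].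
    The automorphisms of [H] cancel in the ratio of the statement, which is therefore
    the number of such matrices times [2 ^ C(s, 2)] divided by
    [n (n - 1) ... (n - s + 1)] (copies_ratioE, card_embeddings_odd_vector_graph).

    The matrices are counted row by row.  If [j] rows have been chosen and they span
    with [1] a space of dimension [r], the next row solves a linear system of rank
    [r]: there are at most [2 ^ (k - r)] solutions, exactly [2 ^ (k - 1 - j)] when
    [r = j + 1], and at most [2 ^ (r - 1)] of them lie in the span, because half of
    the span is odd.  Three consequences:

    - For every [H], keeping only independent rows gives at least
      [\prod_j (2 ^ (k - 1 - j) - 2 ^ j)] matrices (card_free_gram_ge).  In the other
      direction a dependent row is cheap but makes all the later rows less
      constrained; weighting each matrix by [2 ^ (t * defect)], with [t] the number
      of rows still to come, absorbs this gain, and the count is at most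
      [\prod_j (2 ^ (k - 1 - j) + 2 ^ (s - 1))] (weighted_gram_le).  Both products
      match the random graph up to a relative error of order [4 ^ s / N], which is
      at most [1 / ln n] for [s <= log2 n / 2 - ln (ln n) / (2 ln 2)].

    - Independent sets are orthonormal families.  Orthonormal vectors are
      independent, whence the independence number [k]; moreover a family that can
      still be extended is independent of [1] as well, and at most one
      solution of the next system is in the span.  The relative error drops to
      order [2 ^ s / N].

    - For cliques, choose [m] vectors that are independent together with [1].  The
      [2 ^ m] odd vectors of their span have pairwise inner product 1, and each
      further vertex may be taken among them (clique_step), where the random graph
      would only offer about [2 ^ (2m - j)] choices at step [j].  The gain is
      [\prod_(m <= j < s) 2 ^ (j - m) = 2 ^ C(s - m, 2)], and the loss on the first [m]
      vertices is [\prod_(i >= 1) (1 - 4 ^ - i) >= 11 / 16 > exp (- 2 / 3)]. *)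

(** * Embeddings, copies and the expectation in G(n, 1/2) *)

Definition embeddings (T U : finType) (G : sgraph T) (H : sgraph U) :
    {set {ffun U -> T}} :=
  [set f : {ffun U -> T} | injectiveb f & [forall x, forall y, adj G (f x) (f y) == adj H x y]].

Lemma embeddingsP (T U : finType) (G : sgraph T) (H : sgraph U) (f : {ffun U -> T}) :
  reflect (injective f /\ forall x y, adj G (f x) (f y) = adj H x y)
          (f \in embeddings G H).
Proof.
rewrite inE; apply: (iffP andP) => -[/injectiveP finj fadj]; split=> //.
  by move=> x y; apply/eqP; move/forallP/(_ x)/forallP/(_ y): fadj.
by apply/forallP => x; apply/forallP => y; rewrite fadj.
Qed.

Lemma card_automorphisms_gt0 (U : finType) (H : sgraph U) :
  (0 < #|embeddings H H|)%N.
Proof.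
apply/card_gt0P; exists [ffun x => x]; apply/embeddingsP.
by split=> [x y|x y]; rewrite !ffunE.
Qed.

(** Copies of [H] are vertex sets and embeddings are maps: the copies are exactly the
    images of the embeddings, which is what lets maps be counted instead of sets. *)
Lemma isomorphic_induced_image (T U : finType) (G : sgraph T) (H : sgraph U)
    (A : {set T}) :
  reflect (exists2 f, f \in embeddings G H & f @: [set: U] = A)
          (isomorphic (Defs.induced G A) H).
Proof.
apply: (iffP existsP) => [[g /and3P[/injectiveP ginj /forallP gsur /forallP gadj]]|].
  pose f := [ffun y => val (iinv (gsur y))].
  have gK y : g (iinv (gsur y)) = y by rewrite f_iinv.
  exists f; first apply/embeddingsP.
    split=> x y; rewrite !ffunE; first by move=> /val_inj exy; rewrite -[x]gK exy gK.
    move/forallP: (gadj (iinv (gsur x))) => /(_ (iinv (gsur y))) /eqP.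
    by rewrite !gK /Defs.induced adj_mk_sgraph => ->.
  apply/setP => a; apply/imsetP/idP => [[y _ ->]|aA].
    by rewrite ffunE; apply: valP.
  exists (g (exist _ a aA)) => //; rewrite ffunE.
  by rewrite (ginj _ (exist _ a aA) (gK _)).
move=> [f /embeddingsP[finj fadj] fA].
have pre (a : {x : T | x \in A}) : exists y, f y == val a.
  have : val a \in f @: [set: U] by rewrite fA; apply: valP.
  by case/imsetP => y _ ->; exists y.
pose g := [ffun a => xchoose (pre a)].
have gK a : f (g a) = val a by rewrite ffunE; apply/eqP/(xchooseP (pre a)).
exists g; apply/and3P; split.
- by apply/injectiveP => a b gab; apply: val_inj; rewrite -!gK gab.
- apply/forallP => y; have fyA : f y \in A by rewrite -fA imset_f.
  by apply/codomP; exists (exist _ (f y) fyA); apply: finj; rewrite gK.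
- apply/forallP => a; apply/forallP => b.
  by rewrite -fadj !gK /Defs.induced adj_mk_sgraph.
Qed.

(** Embeddings with the same image differ by an automorphism of [H]. *)
Lemma card_embeddings_onto (T U : finType) (G : sgraph T) (H : sgraph U)
    (f : {ffun U -> T}) :
  f \in embeddings G H ->
  #|[set g in embeddings G H | g @: [set: U] == f @: [set: U]]|
    = #|embeddings H H|.
Proof.
move=> /embeddingsP[finj fadj].
pose comp (h : {ffun U -> U}) : {ffun U -> T} := [ffun x => f (h x)].
have comp_inj : injective comp.
  move=> h h' /ffunP hh'; apply/ffunP => x; apply: finj.
  by have := hh' x; rewrite !ffunE.
rewrite -(card_imset _ comp_inj); apply: eq_card => g.
rewrite inE; apply/andP/imsetP => [[/embeddingsP[ginj gadj] /eqP gf]|].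
  have pre x : exists y, f y == g x.
    have : g x \in f @: [set: U] by rewrite -gf imset_f.
    by case/imsetP => y _ ->; exists y.
  pose h := [ffun x => xchoose (pre x)].
  have hK x : f (h x) = g x by rewrite ffunE; apply/eqP/(xchooseP (pre x)).
  exists h; last by apply/ffunP => x; rewrite ffunE hK.
  apply/embeddingsP; split=> [x y hxy|x y]; first by apply: ginj; rewrite -!hK hxy.
  by rewrite -fadj !hK.
move=> [h /embeddingsP[hinj hadj] ->]; split.
  apply/embeddingsP; split=> [x y|x y]; rewrite !ffunE ?fadj ?hadj //.
  by move=> /finj /hinj.
apply/eqP/setP => a; apply/imsetP/imsetP => -[x _ ->].
  by exists (h x); rewrite ?ffunE.
by exists (invF hinj x); rewrite ?ffunE ?f_invF.
Qed.

Lemma card_embeddings (T U : finType) (G : sgraph T) (H : sgraph U) :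
  #|embeddings G H| = (induced_copies G H * #|embeddings H H|)%N.
Proof.
rewrite /induced_copies -sum_nat_const -sum1_card.
rewrite (partition_big (fun f : {ffun U -> T} => f @: [set: U])
  (fun A => isomorphic (Defs.induced G A) H)) /=; last first.
  by move=> f fE; apply/isomorphic_induced_image; exists f.
apply: eq_bigr => A /isomorphic_induced_image[f fE <-].
by rewrite -(card_embeddings_onto fE) -sum1_card; apply: eq_bigl => g; rewrite inE.
Qed.

Lemma card_lt_pairs n : #|[set p : 'I_n * 'I_n | (p.1 < p.2)%N]| = 'C(n, 2).
Proof.
rewrite -sum1_card (eq_bigl (fun p : 'I_n * 'I_n => true && (p.1 < p.2)%N)); last first.
  by move=> p; rewrite inE.
rewrite -(pair_big_dep xpredT (fun i j : 'I_n => (i < j)%N) (fun _ _ => 1%N)) /=.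
rewrite (exchange_big_dep xpredT) //= -bin2_sum big_mkord.
apply: eq_bigr => j _; rewrite sum1_card.
have widen_inj : injective (widen_ord (ltnW (ltn_ord j))).
  by move=> a b /(congr1 val) /= /val_inj.
rewrite -[RHS](card_ord j) -(fintype.card_image widen_inj).
apply: eq_card => i; apply/idP/fintype.imageP => [ij|[h _ ->]] /=.
  by exists (Ordinal ij) => //; apply: val_inj.
exact: (ltn_ord h).
Qed.

(** A graph is determined by the set of its edges [u < v], and any set will do. *)
Lemma card_sgraph n : #|{: sgraph 'I_n}| = (2 ^ 'C(n, 2))%N.
Proof.
pose S := [set p : 'I_n * 'I_n | (p.1 < p.2)%N].
pose up (G : sgraph 'I_n) := [set p in S | adj G p.1 p.2].
have up_inj : injective up.
  move=> G G' GG'; apply/val_inj/ffunP => -[x y] /=.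
  rewrite -[LHS]/(adj G x y) -[RHS]/(adj G' x y).
  wlog xy : x y / (x <= y)%N => [hw|].
    by case/orP: (leq_total x y) => /hw //; rewrite adj_sym [RHS]adj_sym.
  have [->|nxy] := eqVneq x y; first by rewrite !adj_irr.
  have := congr1 (fun A : {set _} => (x, y) \in A) GG'; rewrite !inE /=.
  by rewrite ltn_neqAle xy andbT [_ != _]nxy.
rewrite -card_lt_pairs -card_powerset -/S -(card_imset _ up_inj).
apply: eq_card => A; rewrite powersetE; apply/imsetP/idP => [[G _ ->]|/fintype.subsetP AS].
  by apply/fintype.subsetP => p; rewrite !inE => /andP[].
pose e (x y : 'I_n) := ((x, y) \in A) || ((y, x) \in A).
have eirr : irreflexive e.
  by move=> x; rewrite /e orbb; apply/negP => /AS; rewrite inE ltnn.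
have esym : symmetric e by move=> x y; rewrite /e orbC.
exists (mk_sgraph eirr esym) => //; apply/setP => -[x y]; rewrite !inE adj_mk_sgraph /e /=.
apply/idP/andP => [xyA|[xy /orP[//|/AS]]].
  by rewrite xyA; split=> //; have := AS _ xyA; rewrite inE.
by rewrite inE /= ltnNge ltnW.
Qed.

(** At [p = 1/2] the random graph is uniform, so expectations are averages. *)
Lemma er_mass_half (R : realType) n (G : sgraph 'I_n) :
  er_mass (2^-1 : R) G = 2^-1 ^+ 'C(n, 2).
Proof.
rewrite /er_mass (pair_big_dep xpredT (fun u v : 'I_n => (u < v)%N)
  (fun u v => if adj G u v then 2^-1 : R else 1 - 2^-1)) /=.
rewrite (eq_bigr (fun _ => 2^-1)); last by move=> p _; case: ifP => // _; field.
rewrite prodr_const -card_lt_pairs; congr (_ ^+ _).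
by apply: eq_card => p; rewrite !inE.
Qed.

(** The pull-backs of the graphs on [n] along an injection of [s] into [n] are equidistributed:
    adding the push-forward of the symmetric difference of [H] and [H'] to
    the edges carries the fibre over [H] into the fibre over [H']. *)
Lemma card_pullback_le s n (f : {ffun 'I_s -> 'I_n}) (H H' : sgraph 'I_s) :
  injective f ->
  (#|[set G : sgraph 'I_n | f \in embeddings G H]|
     <= #|[set G : sgraph 'I_n | f \in embeddings G H']|)%N.
Proof.
move=> finj.
pose D (a b : 'I_n) := [exists x, exists y,
  [&& f x == a, f y == b & adj H x y != adj H' x y]].
have Df x y : D (f x) (f y) = (adj H x y != adj H' x y).
  apply/existsP/idP => [[x' /existsP[y' /and3P[/eqP/finj-> /eqP/finj->]]] //|xy].
  by exists x; apply/existsP; exists y; rewrite !eqxx.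
have Dirr : irreflexive D.
  move=> a; apply/existsP => -[x /existsP[y /and3P[/eqP fx /eqP fy]]].
  by rewrite (finj x y) ?fx ?fy // !adj_irr.
have Dsym : symmetric D.
  suff Dimp a b : D a b -> D b a by move=> a b; apply/idP/idP => /Dimp.
  case/existsP => x /existsP[y /and3P[fx fy xy]]; apply/existsP; exists y.
  by apply/existsP; exists x; rewrite fx fy adj_sym [adj H' y x]adj_sym.
have xirr (G : sgraph 'I_n) : irreflexive (fun a b => adj G a b (+) D a b).
  by move=> a; rewrite adj_irr Dirr.
have xsym (G : sgraph 'I_n) : symmetric (fun a b => adj G a b (+) D a b).
  by move=> a b; rewrite adj_sym Dsym.
pose flip G := mk_sgraph (xirr G) (xsym G).
have flip_inj : injective flip.
  move=> G G' GG'; apply/val_inj/ffunP => -[x y] /=.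
  rewrite -[LHS]/(adj G x y) -[RHS]/(adj G' x y).
  have := congr1 (fun K => adj K x y (+) D x y) GG'.
  by rewrite !adj_mk_sgraph -!addbA addbb !addbF.
rewrite -(card_imset _ flip_inj); apply/subset_leq_card/fintype.subsetP => K.
case/imsetP => G; rewrite inE => /embeddingsP[_ fadj] ->; rewrite inE.
apply/embeddingsP; split=> // x y; rewrite adj_mk_sgraph fadj Df.
by case: adj; case: adj.
Qed.

(** There are [2 ^ 'C(s, 2)] fibres, of equal size by [card_pullback_le]. *)
Lemma card_pullback s n (f : {ffun 'I_s -> 'I_n}) (H : sgraph 'I_s) :
  injective f ->
  (#|[set G : sgraph 'I_n | f \in embeddings G H]| * 2 ^ 'C(s, 2))%N
    = (2 ^ 'C(n, 2))%N.
Proof.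
move=> finj; rewrite -!card_sgraph mulnC.
have pirr (G : sgraph 'I_n) : irreflexive (fun x y => adj G (f x) (f y)).
  by move=> x; rewrite adj_irr.
have psym (G : sgraph 'I_n) : symmetric (fun x y => adj G (f x) (f y)).
  by move=> x y; rewrite adj_sym.
rewrite -[RHS]sum1_card.
rewrite (partition_big (fun G => mk_sgraph (pirr G) (psym G)) xpredT) //=.
rewrite -sum_nat_const; apply: eq_bigr => H' _.
transitivity #|[set G : sgraph 'I_n | f \in embeddings G H']|.
  by apply/eqP; rewrite eqn_leq !card_pullback_le.
rewrite -sum1_card; apply: eq_bigl => G; rewrite inE.
apply/embeddingsP/eqP => [[_ fadj]|<-].
  apply/val_inj/ffunP => -[x y] /=.
  by rewrite -[LHS]/(adj (mk_sgraph (pirr G) (psym G)) x y) adj_mk_sgraph fadj.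
by split=> // x y; rewrite adj_mk_sgraph.
Qed.

Lemma er_expectation_embeddings (R : realType) s n (H : sgraph 'I_s) :
  er_expectation (2^-1 : R) (fun G : sgraph 'I_n => #|embeddings G H|%:R)
    = (n ^_ s)%:R / (2 ^ 'C(s, 2))%:R.
Proof.
rewrite /er_expectation (eq_bigr (fun G : sgraph 'I_n =>
  2^-1 ^+ 'C(n, 2) * #|embeddings G H|%:R)); last first.
  by move=> G _; rewrite er_mass_half.
rewrite -big_distrr /= -natr_sum.
have -> : (\sum_(G : sgraph 'I_n) #|embeddings G H|
    = \sum_(f : {ffun 'I_s -> 'I_n} | injectiveb f)
        #|[set G : sgraph 'I_n | f \in embeddings G H]|)%N.
  transitivity (\sum_(G : sgraph 'I_n) \sum_(f : {ffun 'I_s -> 'I_n} |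
     f \in embeddings G H) 1)%N; first by apply: eq_bigr => G _; rewrite sum1_card.
  rewrite (exchange_big_dep (fun f : {ffun 'I_s -> 'I_n} => injectiveb f)) /=.
    by apply: eq_bigr => f _; rewrite -sum1_card; apply: eq_bigl => G; rewrite inE.
  by move=> G f _ /embeddingsP[/injectiveP].
have two_neq0 j : (2 ^ j)%:R != 0 :> R by rewrite pnatr_eq0 expn_eq0.
apply: (mulIf (two_neq0 'C(s, 2))); rewrite divfK // -mulrA -natrM big_distrl /=.
rewrite (eq_bigr (fun _ => 2 ^ 'C(n, 2))%N); last first.
  by move=> f /injectiveP; apply: card_pullback.
rewrite sum_nat_const natrM mulrC -mulrA natrX exprVn mulfV ?mulr1 -?natrX //.
congr _%:R; rewrite -[n in RHS]card_ord -[s in RHS]card_ord -card_inj_ffuns.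
by apply: eq_card => f; rewrite !inE.
Qed.

(** Numerator and denominator both carry the factor [#|embeddings H H|]. *)
Lemma copies_ratioE (R : realType) k s (H : sgraph 'I_s) :
  copies_ratio R k H = (#|embeddings (odd_vector_graph k) H| * 2 ^ 'C(s, 2))%:R
     / (order_of k ^_ s)%:R.
Proof.
have aut_neq0 : #|embeddings H H|%:R != 0 :> R.
  by rewrite pnatr_eq0 -lt0n card_automorphisms_gt0.
rewrite /copies_ratio.
have -> : er_expectation (2^-1 : R) (fun G : sgraph 'I_(order_of k) =>
    (induced_copies G H)%:R)
  = (order_of k ^_ s)%:R / (2 ^ 'C(s, 2))%:R / #|embeddings H H|%:R.
  rewrite -(er_expectation_embeddings R (order_of k) H) /er_expectation big_distrl /=.
  by apply: eq_bigr => G _; rewrite card_embeddings natrM mulrA mulfK.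
by rewrite (card_embeddings (odd_vector_graph k)) !natrM !invfM !invrK; ring.
Qed.

(** * Linear algebra over F_2 *)

Lemma F2_cases (x : 'F_2) : x = (x == 1)%:R.
Proof. by case: x => [[|[|//]]] i; apply: val_inj. Qed.

Lemma F2_addxx (x : 'F_2) : x + x = 0.
Proof. by rewrite [x]F2_cases; case: (x == 1); apply: val_inj. Qed.

Lemma F2_mulxx (x : 'F_2) : x * x = x.
Proof. by rewrite [x]F2_cases; case: (x == 1); apply: val_inj. Qed.

Lemma card_rowspace (F : finFieldType) p k (A : 'M[F]_(p, k)) :
  #|[set x : 'rV[F]_k | (x <= A)%MS]| = (#|F| ^ \rank A)%N.
Proof. by rewrite -card_rowg; apply: eq_card => x; rewrite !inE. Qed.

Lemma card_affine_mul p k (A : 'M['F_2]_(p, k)) (b : 'rV_p) (x0 : 'rV_k) :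
  x0 *m A^T = b -> (#|[set x : 'rV_k | x *m A^T == b]| * 2 ^ \rank A)%N = (2 ^ k)%N.
Proof.
move=> x0b; have -> : #|[set x : 'rV_k | x *m A^T == b]|
    = #|[set x : 'rV_k | (x <= kermx A^T)%MS]|.
  rewrite -(card_imset _ (addIr (- x0))); apply: eq_card => y.
  apply/imsetP/idP => [[x]|]; rewrite inE.
    by move=> /eqP xb ->; rewrite inE; apply/sub_kermxP; rewrite mulmxBl xb x0b subrr.
  move/sub_kermxP => yA; exists (y + x0); last by rewrite addrK.
  by rewrite inE mulmxDl yA x0b add0r.
rewrite card_rowspace card_Fp // mxrank_ker mxrank_tr -expnD subnK //; exact: rank_leq_col.
Qed.

Lemma card_affine_le p k (A : 'M['F_2]_(p, k)) (b : 'rV_p) :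
  (#|[set x : 'rV_k | x *m A^T == b]| <= 2 ^ (k - \rank A))%N.
Proof.
have [->|/set0Pn[x0]] := eqVneq [set x : 'rV_k | x *m A^T == b] finset.set0.
  by rewrite cards0.
rewrite inE => /eqP/card_affine_mul cardE.
have two_gt0 : (0 < 2 ^ \rank A)%N by rewrite expn_gt0.
by rewrite -(leq_pmul2r two_gt0) cardE -expnD subnK ?rank_leq_col.
Qed.

Lemma card_affine_free p k (A : 'M['F_2]_(p, k)) (b : 'rV_p) :
  row_free A -> #|[set x : 'rV_k | x *m A^T == b]| = (2 ^ (k - p))%N.
Proof.
move=> Afree; have Arank : \rank A = p by apply/eqP.
have /card_affine_mul/eqP : (b *m (pinvmx A^T)) *m A^T = b.
  by apply: mulmxKpV; rewrite submx_full // /row_full mxrank_tr Arank.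
rewrite Arank => /eqP cardE; have pk : (p <= k)%N by rewrite -Arank rank_leq_col.
have two_gt0 : (0 < 2 ^ p)%N by rewrite expn_gt0.
by apply/eqP; rewrite -(eqn_pmul2r two_gt0) cardE -expnD subnK.
Qed.

Definition ones k : 'rV['F_2]_k := const_mx 1.

(** The all-ones row records that the next row is odd: the equation of oddness is one
    more inner product, so that all the constraints on it form one linear system. *)
Definition with_ones j k (U : 'M['F_2]_(j, k)) : 'M['F_2]_(1 + j, k) := col_mx (ones k) U.

Definition gram_set j k (B : 'M['F_2]_j) : {set 'M['F_2]_(j, k)} :=
  [set U | U *m U^T == B].

(** Over F_2 squaring is the identity, so the quadratic condition [<x, x> = 1] is the
    linear condition [<x, ones> = 1]. *)
Lemma dot_self k (x : 'rV['F_2]_k) : x *m x^T = x *m (ones k)^T.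
Proof.
apply/matrixP => i j; rewrite !mxE; apply: eq_bigr => l _.
by rewrite !mxE [j]ord1 [i]ord1 F2_mulxx mulr1.
Qed.

Lemma dot_ones k : odd k -> ones k *m (ones k)^T = 1%:M.
Proof.
move=> kodd; apply/matrixP => i j; rewrite !mxE !ord1 eqxx /=.
rewrite (eq_bigr (fun=> 1)) => [|l _]; last by rewrite !mxE mulr1.
rewrite sumr_const card_ord -[k]odd_double_half kodd -addnn !mulrnDr.
by rewrite F2_addxx addr0.
Qed.

Lemma scalar11_F2 (a : 'M['F_2]_1) : a != 1%:M -> a = 0.
Proof.
move=> a1; rewrite [a]mx11_scalar [a 0 0]F2_cases; case: eqP => [a00|_].
  by case/eqP: a1; rewrite [a]mx11_scalar a00.
by rewrite raddf0.
Qed.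

(** The step of every count: putting [x] on top of [U] amounts to solving a linear
    system for [x] with matrix [with_ones U]. *)
Lemma gram_set_col_mx j k (B : 'M['F_2]_(1 + j)) (x : 'rV_k) (U : 'M['F_2]_(j, k)) :
  B^T = B -> (forall i, B i i = 1) ->
  (col_mx x U \in gram_set k B)
    = (U \in gram_set k (drsubmx B))
      && (x *m (with_ones U)^T == row_mx 1%:M (ursubmx B)).
Proof.
move=> Bsym Bdiag; rewrite !inE tr_col_mx mul_col_row tr_col_mx mul_mx_row.
have Bul : ulsubmx B = 1%:M.
  by apply/matrixP => a b; rewrite !mxE !ord1 Bdiag.
have Bdl : dlsubmx B = (ursubmx B)^T by rewrite trmx_ursub Bsym.
rewrite -[B in LHS]submxK Bul Bdl -dot_self.
apply/eqP/andP => [/eq_block_mx[-> -> _ ->] //|[/eqP-> /eqP/eq_row_mx[-> xU]]].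
by rewrite xU -[U *m x^T]trmxK trmx_mul trmxK xU.
Qed.

Lemma sum_col_mx j k (S : {set 'M['F_2]_(1 + j, k)}) (F : 'M['F_2]_(1 + j, k) -> nat) :
  (\sum_(U in S) F U
    = \sum_(U : 'M['F_2]_(j, k)) \sum_(x : 'rV_k | col_mx x U \in S) F (col_mx x U))%N.
Proof.
rewrite pair_big_dep /= (reindex (fun p : 'M['F_2]_(j, k) * 'rV_k => col_mx p.2 p.1)) //=.
exists (fun V : 'M['F_2]_(1 + j, k) => (dsubmx V, usubmx V)) => [[U x]|V] _ /=.
  by rewrite col_mxKd col_mxKu.
by rewrite vsubmxK.
Qed.

Lemma rank_with_ones_col_mx j k (x : 'rV['F_2]_k) (U : 'M['F_2]_(j, k)) :
  \rank (with_ones (col_mx x U))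
    = (\rank (with_ones U) + ~~ (x <= with_ones U)%MS)%N.
Proof.
have sub_col p q (A : 'M['F_2]_(p, k)) (B : 'M['F_2]_(q, k)) :
    (A <= col_mx A B)%MS && (B <= col_mx A B)%MS.
  by rewrite -!addsmxE addsmxSl addsmxSr.
have -> : \rank (with_ones (col_mx x U)) = \rank (x + with_ones U)%MS.
  apply: eqmx_rank; rewrite addsmx_sub /with_ones !col_mx_sub.
  have /andP[onesl xUl] := sub_col _ _ (ones k) (col_mx x U).
  have /andP[xl Ul] := sub_col _ _ x U.
  have /andP[onesr Ur] := sub_col _ _ (ones k) U.
  rewrite onesl addsmxSl (submx_trans onesr (addsmxSr _ _)).
  rewrite (submx_trans Ur (addsmxSr _ _)) (submx_trans xl xUl).
  by rewrite (submx_trans Ul xUl).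
case: (boolP (x <= _)%MS) => xU /=.
  by rewrite addn0; apply/eqmx_rank/eqmxP/addsmx_idPr.
have x_neq0 : x != 0 by apply: contraNneq xU => ->; apply: sub0mx.
rewrite mxrank_disjoint_sum; first by rewrite addnC rank_rV x_neq0.
apply/eqP; rewrite -mxrank_eq0 -leqn0 leqNgt; apply: contra xU => cap_gt0.
suff /andP[_ xcap] : (x :&: with_ones U == x)%MS.
  by apply: submx_trans xcap (capmxSr _ _).
rewrite -mxrank_leqif_eq ?capmxSl // eqn_leq mxrankS ?capmxSl //=.
by rewrite rank_rV x_neq0.
Qed.

Lemma rank_with_ones_gt0 j k (U : 'M['F_2]_(j, k)) : (0 < k)%N ->
  (0 < \rank (with_ones U))%N.
Proof.
case: k U => // k U _; rewrite lt0n mxrank_eq0; apply/eqP => /matrixP/(_ (lshift j 0) 0).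
by rewrite col_mxEu !mxE.
Qed.

(** As [k] is odd, [ones] is odd, so adding it exchanges the odd and the even vectors of
    any space that contains it. *)
Lemma card_odd_span j k (U : 'M['F_2]_(j, k)) : odd k ->
  (#|[set x | (x <= with_ones U)%MS && (x *m (ones k)^T == 1%:M)]| * 2)%N
    = (2 ^ \rank (with_ones U))%N.
Proof.
move=> kodd; have := card_rowspace (with_ones U); rewrite card_Fp // => <-.
set S := [set x | (x <= with_ones U)%MS].
pose O := [set x : 'rV['F_2]_k | x *m (ones k)^T == 1%:M].
have -> : [set x | (x <= with_ones U)%MS && (x *m (ones k)^T == 1%:M)] = S :&: O.
  by apply/setP => x; rewrite !inE.
rewrite -(cardsID O S) muln2 -addnn; congr addn.
rewrite -(card_imset _ (addIr (ones k))); apply: eq_card => x.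
have onesU : (ones k <= with_ones U)%MS.
  by rewrite /with_ones -addsmxE addsmxSl.
apply/idP/imsetP => [|[y]]; rewrite !inE.
  move=> /andP[xU /eqP x1]; exists (x + ones k).
    rewrite !inE mulmxDl x1 dot_ones // addmx_sub // andbT -mulr2n.
    by apply/eqP => /matrixP/(_ 0 0); rewrite !mxE F2_addxx.
  by apply/rowP => i; rewrite !mxE -addrA F2_addxx addr0.
move=> /andP[/scalar11_F2 y0 yU] ->.
by rewrite mulmxDl y0 add0r dot_ones // eqxx addmx_sub.
Qed.

(** * Matrices with a given Gram matrix: upper bound *)

Lemma drsubmx_sym j (B : 'M['F_2]_(1 + j)) : B^T = B -> (drsubmx B)^T = drsubmx B.
Proof. by move=> Bsym; rewrite trmx_drsub Bsym. Qed.

Lemma drsubmx_diag j (B : 'M['F_2]_(1 + j)) :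
  (forall i, B i i = 1) -> forall i, drsubmx B i i = 1.
Proof. by move=> Bdiag i; rewrite !mxE. Qed.

Lemma rank_with_ones_le j k (U : 'M['F_2]_(j, k)) : (\rank (with_ones U) <= 1 + j)%N.
Proof. exact: rank_leq_row. Qed.

Lemma card_span_solutions j k (U : 'M['F_2]_(j, k)) (b : 'rV_j) : odd k ->
  (#|[set x | (x *m (with_ones U)^T == row_mx 1%:M b) && (x <= with_ones U)%MS]|
    <= 2 ^ (\rank (with_ones U) - 1))%N.
Proof.
move=> kodd; have rank_gt0 := rank_with_ones_gt0 U (odd_gt0 kodd).
have := card_odd_span U kodd.
rewrite -[X in (2 ^ X)%N](subnK rank_gt0) expnD => /eqP; rewrite eqn_pmul2r // => /eqP <-.
apply/subset_leq_card/fintype.subsetP => x; rewrite !inE tr_col_mx mul_mx_row.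
by move=> /andP[/eqP/eq_row_mx[-> _] ->]; rewrite eqxx.
Qed.

(** The defect [1 + j - \rank (with_ones U)] counts the dependent rows.  A new row outside
    the span keeps the defect, and a defect [e] allows [2 ^ e] times too many such rows,
    which is paid for by lowering the weight from [t.+1] to [t].  A row in the span
    raises the defect, and there are few of them. *)
Lemma sum_extensions_le j k t (U : 'M['F_2]_(j, k)) (b : 'rV_j) : odd k ->
  (\sum_(x : 'rV_k | x *m (with_ones U)^T == row_mx 1%:M b)
      2 ^ (t * (1 + j.+1 - \rank (with_ones (col_mx x U))))
    <= (2 ^ (k - 1 - j) + 2 ^ (j + t)) * 2 ^ (t.+1 * (1 + j - \rank (with_ones U))))%N.
Proof.
move=> kodd; set r := \rank _; set A := with_ones U.
have r_gt0 : (0 < r)%N := rank_with_ones_gt0 U (odd_gt0 kodd).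
have r_le : (r <= 1 + j)%N := rank_with_ones_le U.
have rk : (r <= k)%N := rank_leq_col _.
pose X := [set x : 'rV['F_2]_k | x *m A^T == row_mx 1%:M b].
pose Y := [set x : 'rV['F_2]_k | (x *m A^T == row_mx 1%:M b) && (x <= A)%MS].
have X_le : (#|X| <= 2 ^ (k - r))%N := card_affine_le A _.
have Y_le : (#|Y| <= 2 ^ (r - 1))%N := card_span_solutions U b kodd.
rewrite (bigID (fun x : 'rV['F_2]_k => (x <= A)%MS)) /= addnC mulnDl leq_add //.
  apply: (@leq_trans (\sum_(x in X) 2 ^ (t * (1 + j - r)))%N).
    rewrite [leqLHS]big_mkcond [leqRHS]big_mkcond; apply: leq_sum => x _.
    rewrite inE rank_with_ones_col_mx; case: ifP => // /andP[-> ->].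
    by rewrite addn1 subSS.
  rewrite sum_nat_const; apply: leq_trans (leq_mul X_le (leqnn _)) _.
  by rewrite -!expnD leq_exp2l //; nia.
rewrite (eq_bigr (fun=> 2 ^ (t * (1 + j.+1 - r)))%N); last first.
  by move=> x /andP[_ xA]; rewrite rank_with_ones_col_mx xA addn0.
rewrite (eq_bigl (fun x => x \in Y)) => [|x]; last by rewrite inE.
rewrite sum_nat_const.
apply: leq_trans (leq_mul Y_le (leqnn _)) _.
by rewrite -!expnD leq_exp2l //; nia.
Qed.

(** The weight [t] is the number of rows that are still to be added; generalizing over it
    makes the induction close, and [t = 0] gives the plain count. *)
Lemma weighted_gram_le j k t (B : 'M['F_2]_j) : odd k ->
  B^T = B -> (forall i, B i i = 1) ->
  (\sum_(U in gram_set k B) 2 ^ (t * (1 + j - \rank (with_ones U)))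
    <= \prod_(i < j) (2 ^ (k - 1 - i) + 2 ^ (j + t - 1)))%N.
Proof.
move=> kodd; elim: j t B => [|j IHj] t B Bsym Bdiag.
  rewrite big_ord0 (eq_bigr (fun=> 1%N)) => [|U _]; last first.
    have := rank_with_ones_gt0 U (odd_gt0 kodd); rewrite -subn_eq0 => /eqP ->.
    by rewrite muln0.
  rewrite sum1_card; apply: leq_trans (max_card _) _.
  by rewrite card_mx mul0n expn0.
have Bsym' := @drsubmx_sym j B Bsym.
have Bdiag' := @drsubmx_diag j B Bdiag.
rewrite (@sum_col_mx j k (gram_set k B)) /= big_ord_recr /= mulnC.
rewrite (bigID (mem (gram_set k (drsubmx (B : 'M['F_2]_(1 + j)))))) /=.
rewrite [X in (_ + X <= _)%N]big1 ?addn0; last first.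
  move=> U UB; rewrite big_pred0 // => x.
  by rewrite gram_set_col_mx // (negbTE UB).
have -> : (j.+1 + t - 1 = j + t)%N by lia.
apply: (@leq_trans (\sum_(U in gram_set k (drsubmx (B : 'M['F_2]_(1 + j))))
    (2 ^ (k - 1 - j) + 2 ^ (j + t)) * 2 ^ (t.+1 * (1 + j - \rank (with_ones U))))%N).
  apply: leq_sum => U UB.
  rewrite (eq_bigl _ _ (fun x => gram_set_col_mx x U Bsym Bdiag)) UB /=.
  exact: sum_extensions_le.
rewrite -big_distrr leq_mul2l /=; apply/orP; right.
have -> : (j + t = j + t.+1 - 1)%N by lia.
exact: IHj.
Qed.

Lemma card_gram_set_le j k (B : 'M['F_2]_j) : odd k ->
  B^T = B -> (forall i, B i i = 1) ->
  (#|gram_set k B| <= \prod_(i < j) (2 ^ (k - 1 - i) + 2 ^ (j - 1)))%N.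
Proof.
move=> kodd Bsym Bdiag; have := @weighted_gram_le j k 0 B kodd Bsym Bdiag.
by rewrite sum1_card addn0.
Qed.

(** * Matrices with a given Gram matrix: lower bounds *)

(** The independent families: for them the linear system for the next row has full
    rank, so that its number of solutions is known exactly. *)
Definition free_gram_set j k (B : 'M['F_2]_j) : {set 'M['F_2]_(j, k)} :=
  [set U in gram_set k B | row_free (with_ones U)].

Lemma row_free_with_ones_col_mx j k (x : 'rV['F_2]_k) (U : 'M['F_2]_(j, k)) :
  row_free (with_ones (col_mx x U))
    = row_free (with_ones U) && ~~ (x <= with_ones U)%MS.
Proof.
rewrite /row_free rank_with_ones_col_mx.
have := rank_with_ones_le U; case: (x <= _)%MS => /= r_le.
  by rewrite andbF addn0; apply/eqP => rE; rewrite rE ltnn in r_le.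
by rewrite andbT addn1 eqSS.
Qed.

Lemma card_free_gram_set0 k (B : 'M['F_2]_0) : odd k -> #|free_gram_set k B| = 1%N.
Proof.
move=> kodd; rewrite (_ : free_gram_set k B = finset.setT) ?cardsT ?card_mx ?mul0n //.
apply/setP => U; rewrite !inE; apply/andP; split.
  by apply/eqP/matrixP => -[].
rewrite /row_free eqn_leq rank_leq_row /=.
exact: rank_with_ones_gt0 (odd_gt0 kodd).
Qed.

Lemma free_gram_step j k d (B : 'M['F_2]_(1 + j)) :
  B^T = B -> (forall i, B i i = 1) ->
  (forall U : 'M['F_2]_(j, k), U \in free_gram_set k (drsubmx B) ->
    (#|[set x | (x *m (with_ones U)^T == row_mx 1%:M (ursubmx B))
               && (x <= with_ones U)%MS]| <= d)%N) ->
  (#|free_gram_set k (drsubmx B)| * (2 ^ (k - 1 - j) - d) <= #|free_gram_set k B|)%N.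
Proof.
move=> Bsym Bdiag span_le; rewrite -[leqRHS]sum1_card (@sum_col_mx j k).
rewrite -sum_nat_const [leqLHS]big_mkcond; apply: leq_sum => U _.
case: ifP => // UB; have := UB; rewrite inE => /andP[UB1 Ufree].
rewrite sum1_card -subnDA -(card_affine_free (row_mx 1%:M (ursubmx B)) Ufree).
set X := [set x | _].
set Y := [set x | (x *m (with_ones U)^T == row_mx 1%:M (ursubmx B)) && (x <= with_ones U)%MS].
apply: leq_trans (leq_sub2l _ (span_le U UB)) _.
have YX : Y \subset X by apply/fintype.subsetP => x; rewrite !inE => /andP[].
rewrite -cardsDS // -/Y; apply/subset_leq_card/fintype.subsetP => x.
move=> /finset.setDP[]; rewrite [x \in X]inE => xX.
rewrite [x \in Y]inE xX /= => xU.
change (col_mx x U \in free_gram_set k B).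
by rewrite inE gram_set_col_mx // UB1 xX row_free_with_ones_col_mx Ufree xU.
Qed.

Lemma card_free_gram_ge j k (B : 'M['F_2]_j) : odd k ->
  B^T = B -> (forall i, B i i = 1) ->
  (\prod_(i < j) (2 ^ (k - 1 - i) - 2 ^ i) <= #|free_gram_set k B|)%N.
Proof.
move=> kodd; elim: j B => [|j IHj] B Bsym Bdiag; first by rewrite big_ord0 card_free_gram_set0.
rewrite big_ord_recr /=.
have Bsym' := @drsubmx_sym j B Bsym; have Bdiag' := @drsubmx_diag j B Bdiag.
apply: leq_trans (leq_mul (IHj _ Bsym' Bdiag') (leqnn _)) _.
apply: free_gram_step => // U; rewrite inE => /andP[_ /eqP Urank].
apply: leq_trans (card_span_solutions U _ kodd) _.
by rewrite Urank add1n subn1.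
Qed.

Lemma drsubmx_1 j : drsubmx (1%:M : 'M['F_2]_(1 + j)) = 1%:M.
Proof. by rewrite (scalar_mx_block 1 j 1) block_mxKdr. Qed.

Lemma ursubmx_1 j : ursubmx (1%:M : 'M['F_2]_(1 + j)) = 0.
Proof. by rewrite (scalar_mx_block 1 j 1) block_mxKur. Qed.

(** A unit diagonal in the Gram matrix makes all the rows odd. *)
Lemma gram_set_ones j k (B : 'M['F_2]_j) (U : 'M['F_2]_(j, k)) :
  (forall i, B i i = 1) -> U \in gram_set k B -> U *m (ones k)^T = const_mx 1.
Proof.
move=> Bdiag; rewrite inE => /eqP UB; apply/matrixP => i l.
have := congr1 (fun M : 'M['F_2]__ => M i i) UB; rewrite Bdiag !mxE => <-.
by apply: eq_bigr => a _; rewrite !mxE F2_mulxx mulr1.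
Qed.

(** Compared with [card_free_gram_ge], orthogonality to [U] leaves a single candidate
    in the span of [ones] and [U]: if [x = a ones + c U], the product with each row of
    [U] gives [c_i = a], and [a = 0] is excluded since [x] is odd. *)
Lemma card_free_orthonormal_ge j k : odd k ->
  (\prod_(i < j) (2 ^ (k - 1 - i) - 1) <= #|free_gram_set k (1%:M : 'M['F_2]_j)|)%N.
Proof.
move=> kodd; elim: j => [|j IHj]; first by rewrite big_ord0 card_free_gram_set0.
rewrite big_ord_recr /=; apply: leq_trans (leq_mul IHj (leqnn _)) _.
rewrite -[X in free_gram_set _ X]drsubmx_1; apply: (@free_gram_step j).
- exact: trmx1.
- by move=> i; rewrite mxE eqxx.
move=> U; rewrite inE drsubmx_1 => /andP[UB _].
have U1 : U *m (ones k)^T = const_mx 1.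
  by apply: (gram_set_ones _ UB) => i; rewrite mxE eqxx.
move: UB; rewrite inE => /eqP UU.
rewrite -[leqRHS](cards1 (ones k + const_mx 1 *m U : 'rV_k)).
apply/subset_leq_card/fintype.subsetP => x; rewrite !inE ursubmx_1.
rewrite tr_col_mx mul_mx_row => /andP[/eqP/eq_row_mx[x1 xU] /submxP[c]].
rewrite -[c]hsubmxK mul_row_col; set a := lsubmx c; set c' := rsubmx c => xE.
have c'E : c' = a *m const_mx 1.
  move: xU; rewrite xE mulmxDl -!mulmxA UU mulmx1.
  rewrite -[ones k *m _]trmxK trmx_mul trmxK U1 trmx_const => /eqP; rewrite addrC addr_eq0.
  move=> /eqP->; apply/matrixP => p q; rewrite !mxE; apply/eqP.
  by rewrite eqr_oppLR -addr_eq0 F2_addxx.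
have [aE|] := eqVneq a 1%:M; first by rewrite xE c'E aE !mul1mx.
move/scalar11_F2 => a0; move: x1; rewrite xE c'E a0 !mul0mx addr0 mul0mx.
by move/matrixP/(_ 0 0); rewrite !mxE.
Qed.

(** * Orthonormal families and cliques *)

(** If [x] extends the orthonormal family [U], then [ones] is not in the span of [U], since
    [x] is orthogonal to [U] and not to [ones].  So the system for [x] has full rank as
    soon as it has a solution. *)
Lemma card_orthonormal_le j k : odd k ->
  (#|gram_set k (1%:M : 'M['F_2]_j)| <= \prod_(i < j) 2 ^ (k - 1 - i))%N.
Proof.
move=> kodd; elim: j => [|j IHj].
  by rewrite big_ord0 (leq_trans (max_card _)) // card_mx mul0n.
have sym1 : (1%:M : 'M['F_2]_(1 + j))^T = 1%:M by exact: trmx1.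
have diag1 i : (1%:M : 'M['F_2]_(1 + j)) i i = 1 by rewrite mxE eqxx.
rewrite big_ord_recr /= -sum1_card (@sum_col_mx j k).
apply: leq_trans (leq_mul IHj (leqnn _)).
rewrite -sum_nat_const [leqRHS]big_mkcond; apply: leq_sum => U _.
rewrite (eq_bigl _ _ (fun x => gram_set_col_mx x U sym1 diag1)) drsubmx_1 ursubmx_1.
case: ifP => UB; last by rewrite big_pred0.
rewrite /= sum1_card; move: (UB); rewrite inE => /eqP UU.
have [/eqP card0|] := posnP #|[pred x : 'rV['F_2]_k | x *m (with_ones U)^T == row_mx 1%:M 0]|.
  by rewrite (eqP card0).
case/card_gt0P => x; rewrite inE => /eqP xE.
have [x1 x0] : x *m (ones k)^T = 1%:M /\ x *m U^T = 0.
  by move: xE; rewrite tr_col_mx mul_mx_row => /eq_row_mx.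
have x1T : ones k *m x^T = 1%:M by rewrite -[LHS]trmxK trmx_mul trmxK x1 trmx1.
have x0T : U *m x^T = 0 by rewrite -[LHS]trmxK trmx_mul trmxK x0 trmx0.
have Ufree : row_free (with_ones U).
  (* A right inverse: [x] is dual to [ones], and the rows of [U], corrected to be
     orthogonal to [ones], are dual to [U]. *)
  apply/row_freeP; exists (row_mx x^T (U^T - x^T *m (ones k *m U^T))).
  rewrite mul_col_row x1T x0T !mulmxBr !mulmxA x1T x0T UU mul1mx !mul0mx subrr subr0.
  by rewrite -scalar_mx_block.
rewrite -subnDA -(card_affine_free (row_mx 1%:M 0) Ufree) subset_leq_card //.
by apply/fintype.subsetP => y; rewrite !inE.
Qed.

(** The part of being an embedding that the Gram matrix does not see. *)
Definition proper_rows j k (U : 'M['F_2]_(j, k)) : bool :=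
  injectiveb (fun i => row i U) && [forall i, row i U != ones k].

Lemma row_free_proper_rows j k (U : 'M['F_2]_(j, k)) :
  row_free (with_ones U) -> proper_rows U.
Proof.
move=> Ufree; have row_inj : injective (fun i => row i (with_ones U)).
  move=> a b; rewrite [RHS]rowE rowE => /(row_free_inj Ufree)/matrixP/(_ 0 b).
  by rewrite !mxE !eqxx /=; case: (b =P a) => // _ /eqP.
have rowr i : row (rshift 1 i) (with_ones U) = row i U.
  by apply/rowP => a; rewrite [LHS]mxE col_mxEd [RHS]mxE.
have rowl : row (lshift j 0) (with_ones U) = ones k.
  by apply/rowP => a; rewrite [LHS]mxE col_mxEu.
apply/andP; split.
  by apply/injectiveP => a b; rewrite -!rowr => /row_inj/rshift_inj.
apply/forallP => i; apply/eqP; rewrite -rowr -rowl => /row_inj/eqP.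
by rewrite eq_rlshift.
Qed.

Lemma proper_rows_col_mx j k (x : 'rV['F_2]_k) (U : 'M['F_2]_(j, k)) :
  proper_rows U -> x != ones k -> x \notin [set row i U | i in 'I_j] ->
  proper_rows (col_mx x U).
Proof.
move=> /andP[/injectiveP Uinj /forallP Uones] x_ones xU.
have rowr i : row (rshift 1 i) (col_mx x U) = row i U.
  by apply/rowP => a; rewrite [LHS]mxE col_mxEd [RHS]mxE.
have rowl i : row (lshift j i) (col_mx x U) = x.
  by apply/rowP => a; rewrite [LHS]mxE col_mxEu [i]ord1.
have x_row i : x <> row i U by move=> xE; case/negP: xU; rewrite xE; apply/imsetP; exists i.
apply/andP; split.
  apply/injectiveP => a b; case: (split_ordP a) => i ->; case: (split_ordP b) => l ->.
  - by rewrite [i]ord1 [l]ord1.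
  - by rewrite rowl rowr => /x_row.
  - by rewrite rowl rowr => /esym/x_row.
  - by rewrite !rowr => /Uinj->.
by apply/forallP => a; case: (split_ordP a) => i ->; rewrite ?rowl ?rowr.
Qed.

(** Once the rank has reached [m + 1] it is kept: the extensions considered in
    [clique_step] stay in the span. *)
Definition clique_set m j k : {set 'M['F_2]_(j, k)} :=
  [set U in gram_set k (const_mx 1) |
    (\rank (with_ones U) == m.+1) && proper_rows U].

(** The Gram matrix of [with_ones U] is constant equal to 1, so an odd vector of its span
    has inner product 1 with each row.  There are [2 ^ m] of them, of which [ones] and
    the [j] rows of [U] are excluded. *)
Lemma clique_step m j k : odd k ->
  (#|clique_set m j k| * (2 ^ m - 1 - j) <= #|clique_set m (1 + j) k|)%N.
Proof.
move=> kodd; rewrite -[leqRHS]sum1_card (@sum_col_mx j k).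
rewrite -sum_nat_const [leqLHS]big_mkcond; apply: leq_sum => U _.
case: ifP => //; rewrite inE => /and3P[UB /eqP Urank Uproper].
have sym1 : (const_mx 1 : 'M['F_2]_(1 + j))^T = const_mx 1 by rewrite trmx_const.
have diag1 i : (const_mx 1 : 'M['F_2]_(1 + j)) i i = 1 by rewrite mxE.
have drsub1 : drsubmx (const_mx 1 : 'M['F_2]_(1 + j)) = const_mx 1.
  by apply/matrixP => a b; rewrite !mxE.
have ursub1 : ursubmx (const_mx 1 : 'M['F_2]_(1 + j)) = const_mx 1.
  by apply/matrixP => a b; rewrite !mxE.
have U1 : U *m (ones k)^T = const_mx 1.
  by apply: (gram_set_ones _ UB) => i; rewrite mxE.
have UU : U *m U^T = const_mx 1 by apply/eqP; move: UB; rewrite inE.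
have U1T : ones k *m U^T = const_mx 1.
  by rewrite -[LHS]trmxK trmx_mul trmxK U1 trmx_const.
have one1 : ones k *m (ones k)^T = const_mx 1.
  by rewrite dot_ones //; apply/matrixP => a b; rewrite !mxE !ord1 eqxx.
have AA : with_ones U *m (with_ones U)^T = const_mx 1.
  rewrite tr_col_mx mul_col_row one1 U1T U1 UU.
  apply/matrixP => a b.
  by case: (split_ordP a) => i ->; case: (split_ordP b) => l ->;
    rewrite ?block_mxEul ?block_mxEur ?block_mxEdl ?block_mxEdr !mxE.
pose S := [set x | (x <= with_ones U)%MS && (x *m (ones k)^T == 1%:M)].
pose T := [set row i U | i in 'I_j].
have S_card : #|S| = (2 ^ m)%N.
  have := card_odd_span U kodd; rewrite -/S Urank expnS mulnC => /eqP.
  by rewrite eqn_mul2l => /eqP.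
have T_card : (#|ones k |: T| <= 1 + j)%N.
  rewrite cardsU1 leq_add ?leq_b1 //.
  by rewrite (leq_trans (leq_imset_card _ _)) // card_ord.
rewrite sum1_card -subnDA -S_card.
apply: leq_trans (leq_sub2l _ T_card) _.
apply: leq_trans (_ : #|S :\: (ones k |: T)| <= _)%N.
  by rewrite cardsD leq_sub2l // subset_leq_card // finset.subsetIr.
apply/subset_leq_card/fintype.subsetP => x.
case/finset.setDP; rewrite [x \in S]inE => /andP[xA /eqP x1].
rewrite finset.in_setU1 negb_or => /andP[x_ones xT].
change (col_mx x U \in clique_set m (1 + j) k).
rewrite inE gram_set_col_mx // drsub1 UB ursub1 rank_with_ones_col_mx xA Urank addn0 eqxx /=.
rewrite proper_rows_col_mx // andbT tr_col_mx mul_mx_row x1.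
apply/eqP; congr row_mx.
case/submxP: xA => c xE; have xAT : x *m (with_ones U)^T = c *m const_mx 1.
  by rewrite xE -mulmxA AA.
move: xAT; rewrite tr_col_mx mul_mx_row x1 => xAT.
apply/rowP => i; have := congr1 (fun M : 'M['F_2]_(1, 1 + j) => M 0 (rshift 1 i)) xAT.
have := congr1 (fun M : 'M['F_2]_(1, 1 + j) => M 0 (lshift j 0)) xAT.
rewrite row_mxEl row_mxEr => e1 ->.
transitivity ((1%:M : 'M['F_2]_1) 0 0); last by rewrite !mxE eqxx.
by rewrite e1 !mxE; apply: eq_bigr => a _; rewrite !mxE.
Qed.

Lemma card_clique_set_ge m d k : k = m.*2.+1 ->
  (\prod_(i < m) (2 ^ (k - 1 - i) - 2 ^ i) * \prod_(i < d) (2 ^ m - 1 - (m + i))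
     <= #|clique_set m (d + m) k|)%N.
Proof.
move=> kE; have kodd : odd k by rewrite kE /= odd_double.
elim: d => [|d IHd].
  rewrite big_ord0 muln1 add0n.
  have sym1 : (const_mx 1 : 'M['F_2]_m)^T = const_mx 1 by rewrite trmx_const.
  have diag1 i : (const_mx 1 : 'M['F_2]_m) i i = 1 by rewrite mxE.
  apply: leq_trans (card_free_gram_ge kodd sym1 diag1) _.
  apply/subset_leq_card/fintype.subsetP => U; rewrite !inE => /andP[-> Ufree] /=.
  by rewrite row_free_proper_rows // andbT.
rewrite big_ord_recr /= mulnA.
apply: leq_trans (leq_mul IHd (leqnn _)) _.
by rewrite (addnC m d); exact: (clique_step m (d + m) kodd).
Qed.

(** * Embeddings into the odd vector graph *)

Definition gram_of s (H : sgraph 'I_s) : 'M['F_2]_s :=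
  \matrix_(i, j) ((i == j) || adj H i j)%:R.

Lemma gram_of_sym s (H : sgraph 'I_s) : (gram_of H)^T = gram_of H.
Proof. by apply/matrixP => i j; rewrite !mxE eq_sym adj_sym. Qed.

Lemma gram_of_diag s (H : sgraph 'I_s) i : gram_of H i i = 1.
Proof. by rewrite mxE eqxx. Qed.

Lemma F2_natr_eq1 n : (n%:R == 1 :> 'F_2) = odd n.
Proof.
by rewrite -[n in LHS]odd_double_half -addnn natrD natrD F2_addxx addr0; case: (odd n).
Qed.

Lemma bool_F2_eq1 (b : bool) : (b%:R == 1 :> 'F_2) = b.
Proof. by case: b. Qed.

Lemma odd_weightE k (v : 'rV['F_2]_k) :
  odd #|[pred i | v 0 i == 1]| = (v *m (ones k)^T == 1%:M).
Proof.
have -> : v *m (ones k)^T = (#|[pred i | v 0 i == 1]|%:R)%:M.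
  apply/matrixP => a b; rewrite !mxE !ord1 eqxx mulr1n -sum1_card natr_sum.
  rewrite [RHS]big_mkcond; apply: eq_bigr => i _.
  by rewrite !mxE mulr1 inE [LHS]F2_cases; case: (v 0 i == 1).
rewrite -F2_natr_eq1; apply/eqP/eqP => [->|/matrixP/(_ 0 0)] //.
by rewrite !mxE eqxx !mulr1n.
Qed.

Lemma gram_entry j k (U : 'M['F_2]_(j, k)) a b :
  (U *m U^T) a b = inner (row a U) (row b U).
Proof. by rewrite mxE; apply: eq_bigr => i _; rewrite !mxE. Qed.

Lemma inner_self k (v : 'rV['F_2]_k) : odd #|[pred i | v 0 i == 1]| -> inner v v = 1.
Proof.
rewrite odd_weightE -dot_self => /eqP/matrixP/(_ 0 0) vv.
transitivity ((1%:M : 'M['F_2]_1) 0 0); last by rewrite mxE eqxx.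
by rewrite -vv mxE; apply: eq_bigr => i _; rewrite mxE.
Qed.

Lemma card_embeddings_odd_vector_graph k s (H : sgraph 'I_s) :
  #|embeddings (odd_vector_graph k) H|
    = #|[set U in gram_set k (gram_of H) | proper_rows U]|.
Proof.
pose mx (f : {ffun 'I_s -> odd_vertex k}) : 'M['F_2]_(s, k) := \matrix_i val (f i).
have rowK f i : row i (mx f) = val (f i) by rewrite rowK.
have mx_inj : injective mx.
  move=> f g fg; apply/ffunP => i; apply: val_inj.
  by rewrite -!rowK fg.
rewrite -(card_imset _ mx_inj); apply: eq_card => U; apply/imsetP/idP.
  move=> [f /embeddingsP[finj fadj] ->]; rewrite inE; apply/andP; split.
    rewrite inE; apply/eqP/matrixP => a b; rewrite gram_entry !rowK [RHS]mxE -fadj.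
    rewrite /odd_vector_graph adj_mk_sgraph /odd_adj (inj_eq finj).
    have [->|_] := eqVneq a b; last by rewrite /= [LHS]F2_cases.
    by rewrite inner_self //; have /andP[] := valP (f b).
  apply/andP; split; first by apply/injectiveP => a b; rewrite !rowK => /val_inj/finj.
  by apply/forallP => i; rewrite rowK; have /andP[] := valP (f i).
rewrite inE => /andP[UB /andP[/injectiveP Uinj /forallP Uones]].
have Uodd i : odd #|[pred a | row i U 0 a == 1]| && (row i U != const_mx 1).
  rewrite odd_weightE [_ != _]Uones andbT.
  have U1 := gram_set_ones (gram_of_diag H) UB.
  by rewrite -row_mul U1; apply/eqP/matrixP => a b; rewrite !mxE !ord1 eqxx.
pose f := [ffun i => (exist _ (row i U) (Uodd i) : odd_vertex k)].
have fE i : val (f i) = row i U by rewrite ffunE.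
exists f; last by apply/row_matrixP => i; rewrite rowK fE.
have finj : injective f by move=> a b /(congr1 val); rewrite !fE => /Uinj.
apply/embeddingsP; split=> // a b; rewrite /odd_vector_graph adj_mk_sgraph /odd_adj.
rewrite (inj_eq finj) !fE -gram_entry; move: UB; rewrite inE => /eqP ->.
by rewrite mxE bool_F2_eq1; case: eqVneq => [->|] //=; rewrite adj_irr.
Qed.

Section Bounds.
Variables (k s : nat) (H : sgraph 'I_s).
Hypothesis kodd : odd k.

Lemma card_embeddings_le :
  (#|embeddings (odd_vector_graph k) H|
     <= \prod_(i < s) (2 ^ (k - 1 - i) + 2 ^ (s - 1)))%N.
Proof.
rewrite card_embeddings_odd_vector_graph.
apply: leq_trans (card_gram_set_le kodd (gram_of_sym H) (gram_of_diag H)).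
by apply/subset_leq_card/fintype.subsetP => U; rewrite inE => /andP[].
Qed.

Lemma card_free_gram_set_le_embeddings :
  (#|free_gram_set k (gram_of H)| <= #|embeddings (odd_vector_graph k) H|)%N.
Proof.
rewrite card_embeddings_odd_vector_graph.
apply/subset_leq_card/fintype.subsetP => U; rewrite !inE => /andP[-> Ufree].
exact: row_free_proper_rows.
Qed.

Lemma card_embeddings_ge :
  (\prod_(i < s) (2 ^ (k - 1 - i) - 2 ^ i) <= #|embeddings (odd_vector_graph k) H|)%N.
Proof.
apply: leq_trans card_free_gram_set_le_embeddings.
exact: card_free_gram_ge (gram_of_sym H) (gram_of_diag H).
Qed.

End Bounds.

Lemma gram_of_empty s : gram_of (empty_graph s) = 1%:M.
Proof. by apply/matrixP => i j; rewrite !mxE /empty_graph adj_mk_sgraph orbF. Qed.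

Lemma gram_of_complete s : gram_of (complete_graph s) = const_mx 1.
Proof. by apply/matrixP => i j; rewrite !mxE /complete_graph adj_mk_sgraph orbN. Qed.

Lemma card_embeddings_empty_le k s : odd k ->
  (#|embeddings (odd_vector_graph k) (empty_graph s)|
     <= \prod_(i < s) 2 ^ (k - 1 - i))%N.
Proof.
move=> kodd; rewrite card_embeddings_odd_vector_graph gram_of_empty.
apply: leq_trans (card_orthonormal_le s kodd).
by apply/subset_leq_card/fintype.subsetP => U; rewrite inE => /andP[].
Qed.

Lemma card_embeddings_empty_ge k s : odd k ->
  (\prod_(i < s) (2 ^ (k - 1 - i) - 1)
     <= #|embeddings (odd_vector_graph k) (empty_graph s)|)%N.
Proof.
move=> kodd; apply: leq_trans (card_free_gram_set_le_embeddings _ _).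
by rewrite gram_of_empty; apply: card_free_orthonormal_ge.
Qed.

Lemma card_embeddings_complete_ge m d k : k = m.*2.+1 ->
  (\prod_(i < m) (2 ^ (k - 1 - i) - 2 ^ i) * \prod_(i < d) (2 ^ m - 1 - (m + i))
     <= #|embeddings (odd_vector_graph k) (complete_graph (d + m))|)%N.
Proof.
move=> kE; apply: leq_trans (card_clique_set_ge d kE) _.
rewrite card_embeddings_odd_vector_graph gram_of_complete.
by apply/subset_leq_card/fintype.subsetP => U; rewrite !inE => /and3P[-> _ ->].
Qed.

(** Orthonormal vectors are linearly independent, which bounds their number by [k]; the
    standard basis attains the bound. *)
Lemma independence_number_odd_vector_graph k : odd k -> (1 < k)%N ->
  independence_number (odd_vector_graph k) = k.
Proof.
move=> kodd k_gt1; apply/eqP; rewrite eqn_leq; apply/andP; split.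
  apply/bigmax_leqP => A /forallP Aind.
  pose U : 'M['F_2]_(#|A|, k) := \matrix_i val (enum_val i : odd_vertex k).
  have UU : U *m U^T = 1%:M.
    apply/matrixP => a b; rewrite gram_entry !rowK mxE.
    have /implyP/(_ (enum_valP a)) /forallP/(_ (enum_val b))
      /implyP/(_ (enum_valP b)) := Aind (enum_val a).
    rewrite /odd_vector_graph adj_mk_sgraph /odd_adj (inj_eq enum_val_inj).
    have [->|_ /=] := eqVneq a b; first by rewrite inner_self //; have /andP[] := valP (enum_val b).
    by move=> /negbTE uv; rewrite [LHS]F2_cases uv.
  have /eqP Ufree : row_free U by apply/row_freeP; exists U^T.
  by rewrite -{1}Ufree rank_leq_col.
have e_odd (i : 'I_k) : odd #|[pred a | (delta_mx 0 i : 'rV['F_2]_k) 0 a == 1]|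
    && (delta_mx 0 i != const_mx 1 :> 'rV['F_2]_k).
  apply/andP; split.
    suff -> : #|[pred a | (delta_mx 0 i : 'rV['F_2]_k) 0 a == 1]| = #|pred1 i|.
      by rewrite card1.
    by apply: eq_card => a; rewrite !inE mxE eqxx bool_F2_eq1.
  apply/eqP => /rowP dE.
  have [j ij] : exists j, j != i.
    apply/existsP; rewrite -[X in is_true X]negbK; apply/negP => /existsPn all_i.
    have : (#|'I_k| <= #|pred1 i|)%N.
      by apply/subset_leq_card/fintype.subsetP => a _; rewrite inE; have := all_i a; rewrite negbK.
    by rewrite card1 card_ord leqNgt k_gt1.
  by have := dE j; rewrite !mxE (negbTE ij).
pose e i : odd_vertex k := exist _ (delta_mx 0 i) (e_odd i).
have e_inj : injective e.
  move=> i j /(congr1 val)/rowP/(_ j); rewrite !mxE !eqxx /=.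
  by case: (j =P i).
have eind : independent (odd_vector_graph k) (e @: [set: 'I_k]).
  apply/forallP => u; apply/implyP => /imsetP[i _ ->].
  apply/forallP => v; apply/implyP => /imsetP[j _ ->].
  rewrite /odd_vector_graph adj_mk_sgraph /odd_adj (inj_eq e_inj).
  have [//|ij /=] := eqVneq i j.
  rewrite (_ : inner _ _ = 0) // /inner big1 // => a _; rewrite !mxE eqxx /=.
  by have [->|] := eqVneq a i; rewrite ?mul0r ?(negbTE ij) ?mulr0.
apply: leq_trans (leq_bigmax_cond _ eind).
by rewrite card_imset // cardsT card_ord.
Qed.

(** * Comparison with the random graph *)

Section Numerics.
Variable R : realType.

Lemma prod_le_expR s (f x : nat -> R) :
  (forall i, (i < s)%N -> 0 <= f i <= 1 + x i) ->
  \prod_(i < s) f i <= expR (\sum_(i < s) x i).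
Proof.
move=> fx; rewrite expR_sum; apply: ler_prod => i _.
have /andP[-> fi] := fx i (ltn_ord i).
exact: le_trans fi (expR_ge1Dx _).
Qed.

Lemma prod_ge_1subr s (f x : nat -> R) :
  (forall i, (i < s)%N -> [/\ 0 <= f i, 0 <= x i & 1 - x i <= f i]) ->
  1 - \sum_(i < s) x i <= \prod_(i < s) f i.
Proof.
elim: s => [|s IHs] fx; first by rewrite !big_ord0 subr0.
have {}IHs := IHs (fun i i_lt => fx i (ltnW i_lt)).
have [f_ge0 x_ge0 fs] := fx s (ltnSn s).
have P_ge0 : 0 <= \prod_(i < s) f i.
  by apply: prodr_ge0 => i _; have [] := fx i (ltnW (ltn_ord i)).
have S_ge0 : 0 <= \sum_(i < s) x i.
  by apply: sumr_ge0 => i _; have [] := fx i (ltnW (ltn_ord i)).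
rewrite !big_ord_recr /=; have [x_le1|x_gt1] := leP (x s) 1; last first.
  by apply: le_trans (mulr_ge0 P_ge0 f_ge0); lra.
apply: le_trans (_ : _ <= (1 - \sum_(i < s) x i) * (1 - x s)) _; first by nra.
apply: le_trans (ler_wpM2r _ IHs) (ler_wpM2l P_ge0 fs); lra.
Qed.

Lemma pow2_binomial s : (2 ^ 'C(s, 2) = \prod_(i < s) 2 ^ i)%N.
Proof. by rewrite -bin2_sum expn_sum big_mkord. Qed.

Lemma copies_ratio_le k s (H : sgraph 'I_s) (a : nat -> nat) :
  (#|embeddings (odd_vector_graph k) H| <= \prod_(i < s) a i)%N ->
  copies_ratio R k H <= \prod_(i < s) ((a i * 2 ^ i)%:R / (order_of k - i)%:R).
Proof.
move=> emb_le; rewrite copies_ratioE big_split /= prodfV -!natr_prod -ffact_prod.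
rewrite ler_wpM2r ?invr_ge0 ?ler0n // ler_nat big_split /= pow2_binomial.
by rewrite leq_mul2r emb_le orbT.
Qed.

Lemma copies_ratio_ge k s (H : sgraph 'I_s) (a : nat -> nat) :
  (\prod_(i < s) a i <= #|embeddings (odd_vector_graph k) H|)%N ->
  \prod_(i < s) ((a i * 2 ^ i)%:R / (order_of k - i)%:R) <= copies_ratio R k H.
Proof.
move=> emb_ge; rewrite copies_ratioE big_split /= prodfV -!natr_prod -ffact_prod.
rewrite ler_wpM2r ?invr_ge0 ?ler0n // ler_nat big_split /= pow2_binomial.
by rewrite leq_mul2r emb_ge orbT.
Qed.

Lemma sum_pow2_le c s : \sum_(i < s) (2 ^ (c + i))%:R <= (2 ^ (c + s))%:R :> R.
Proof.
elim: s => [|s IHs]; first by rewrite big_ord0 ler0n.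
rewrite big_ord_recr /= addnS expnS natrM mulr_natl mulr2n.
exact: lerD.
Qed.

(** Row [i] contributes [(N + y) / (N - 1 - i)] or [(N - y) / (N - 1 - i)] with
    [N = 2 ^ (k - 1)] and [y = 2 ^ (c + i)], hence a relative error [O(y / N)], and the
    sum of the [y] is at most [2 ^ (c + s)].  Arbitrary graphs correspond to [c = s] and
    empty graphs to [c = 0]. *)
Lemma copies_ratio_close k s c (H : sgraph 'I_s) :
  (2 ^ (c + s) <= 2 ^ (k - 1))%N ->
  (#|embeddings (odd_vector_graph k) H| <= \prod_(i < s) (2 ^ (k - 1 - i) + 2 ^ c))%N ->
  (\prod_(i < s) (2 ^ (k - 1 - i) - 2 ^ c) <= #|embeddings (odd_vector_graph k) H|)%N ->
  `|copies_ratio R k H - 1| <= expR (4 * (2 ^ (c + s))%:R / (2 ^ (k - 1))%:R) - 1.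
Proof.
move=> cs_le.
move=> /(copies_ratio_le (a := fun i => (2 ^ (k - 1 - i) + 2 ^ c)%N)) ratio_le.
move=> /(copies_ratio_ge (a := fun i => (2 ^ (k - 1 - i) - 2 ^ c)%N)) ratio_ge.
set N : R := (2 ^ (k - 1))%:R; set X : R := (2 ^ (c + s))%:R.
have N_gt0 : 0 < N by rewrite ltr0n expn_gt0.
(* All that is needed about row [i], in terms of the reals [y = 2 ^ (c + i)] and
   [D = n - i]. *)
have facts i : (i < s)%N -> exists y D : R,
  [/\ (2 ^ (c + i))%:R = y, 1 <= y, y <= N / 2, (order_of k - i)%:R = D & N - y <= D] /\ D <= N /\
  ((2 ^ (k - 1 - i) + 2 ^ c) * 2 ^ i)%:R = N + y /\
  ((2 ^ (k - 1 - i) - 2 ^ c) * 2 ^ i)%:R = N - y.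
  move=> i_lt; exists (2 ^ (c + i))%:R, (order_of k - i)%:R.
  have ci_lt : (c + i < k - 1)%N.
    by rewrite leq_exp2l // in cs_le; lia.
  have two_y : (2 ^ (c + i) * 2 <= 2 ^ (k - 1))%N by rewrite -expnSr leq_exp2l.
  have i_lt_y : (i < 2 ^ (c + i))%N.
    by apply: leq_trans (ltn_expl i (ltnSn 1)) _; rewrite leq_exp2l // leq_addl.
  have ki : (k - 1 - i + i = k - 1)%N by lia.
  split; first split=> //.
  - by rewrite ler1n expn_gt0.
  - by rewrite ler_pdivlMr // -natrM ler_nat.
  - by rewrite lerBlDr -natrD ler_nat /order_of; lia.
  split; first by rewrite ler_nat /order_of; lia.
  split; first by rewrite mulnDl -!expnD ki natrD.
  rewrite mulnBl -!expnD ki natrB //; lia.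
have upper : copies_ratio R k H <= expR (4 * X / N).
  apply: le_trans ratio_le _.
  apply: le_trans (_ : _ <= expR (\sum_(i < s) 4 * (2 ^ (c + i))%:R / N)) _.
    apply: (@prod_le_expR s
      (fun i => ((2 ^ (k - 1 - i) + 2 ^ c) * 2 ^ i)%:R / (order_of k - i)%:R)
      (fun i => 4 * (2 ^ (c + i))%:R / N)) => i i_lt.
    have [y [D [[-> y_ge1 y_le -> D_ge] [D_le [-> _]]]]] := facts i i_lt.
    have D_gt0 : 0 < D by lra.
    rewrite divr_ge0 /=; try lra.
    rewrite ler_pdivrMr //.
    apply: le_trans (_ : (1 + 4 * y / N) * (N - y) <= _); last first.
      by apply: ler_wpM2l => //; have := divr_ge0 (_ : 0 <= 4 * y) (ltW N_gt0); lra.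
    have yN : y / N <= 2^-1 by rewrite ler_pdivrMr // mulrC.
    have -> : (1 + 4 * y / N) * (N - y) = N + 3 * y - 4 * y * (y / N).
      by field; rewrite gt_eqF.
    nra.
  rewrite ler_expR -mulr_suml -mulr_sumr ler_wpM2r ?invr_ge0 ?(ltW N_gt0) //.
  by rewrite ler_wpM2l // sum_pow2_le.
have lower : 1 - X / N <= copies_ratio R k H.
  apply: le_trans _ ratio_ge.
  apply: le_trans (_ : 1 - \sum_(i < s) ((2 ^ (c + i))%:R / N) <= _).
    rewrite lerB // -mulr_suml ler_wpM2r ?invr_ge0 ?(ltW N_gt0) //.
    exact: sum_pow2_le.
  apply: (@prod_ge_1subr s
    (fun i => ((2 ^ (k - 1 - i) - 2 ^ c) * 2 ^ i)%:R / (order_of k - i)%:R)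
    (fun i => (2 ^ (c + i))%:R / N)) => i i_lt.
  have [y [D [[-> y_ge1 y_le -> D_ge] [D_le [_ ->]]]]] := facts i i_lt.
  have D_gt0 : 0 < D by lra.
  split; [by apply: divr_ge0; lra|by apply: divr_ge0; lra|].
  rewrite ler_pdivlMr //; have -> : 1 - y / N = (N - y) / N by field; rewrite gt_eqF.
  by rewrite mulrAC ler_pdivrMr // ler_wpM2l //; lra.
have XN : 0 <= X / N by rewrite divr_ge0 ?ler0n.
have := expR_ge1Dx (4 * X / N); rewrite -mulrA in upper * => expX.
rewrite ler_norml; apply/andP; split; lra.
Qed.

End Numerics.

Section CliqueNumerics.
Variable R : realType.

(** The infinite product [\prod_(i >= 1) (1 - 4 ^ - i)] is about 0.6885.  The extra term
    [(4 ^ m)^-1 / 4] makes the lower bound 11/16 inductive. *)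
Lemma prod_quarters_ge m : (0 < m)%N ->
  11 / 16 + (4 ^ m)%:R^-1 / 4 <= \prod_(i < m) (1 - (4 ^ i)%:R / (4 ^ m)%:R) :> R.
Proof.
case: m => // m _; elim: m => [|m IHm]; first by rewrite big_ord_recl big_ord0 /=; lra.
rewrite big_ord_recl /= expn0.
rewrite (eq_bigr (fun i : 'I_m.+1 => 1 - (4 ^ i)%:R / (4 ^ m.+1)%:R)); last first.
  move=> i _; congr (1 - _); rewrite /bump /= add1n (expnS 4 i) (expnS 4 m.+1) !natrM.
  by rewrite invfM mulrACA divff ?mul1r // pnatr_eq0.
rewrite (expnS 4 m.+1) natrM invfM mul1r.
set x := (4 ^ m.+1)%:R^-1 in IHm *.
have x_gt0 : 0 < x by rewrite invr_gt0 ltr0n expn_gt0.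
have x_le : x <= 1 / 4.
  by rewrite div1r lef_pV2 ?posrE ?ltr0n ?expn_gt0 // ler_nat expnS leq_pmulr // expn_gt0.
apply: le_trans (_ : _ <= (1 - 4^-1 * x) * (11 / 16 + x / 4)) _; first by nra.
by apply: ler_wpM2l => //; lra.
Qed.

Lemma prod_split (g : nat -> R) d m :
  \prod_(i < d + m) g i = \prod_(i < m) g i * \prod_(i < d) g (m + i)%N.
Proof. by rewrite addnC big_split_ord. Qed.

(** The first [m] vertices lose at most the factor 11/16.  The vertex number [m + i] has at
    least [2 ^ m - s] choices against about [4 ^ m / 2 ^ (m + i) = 2 ^ m / 2 ^ i] in the
    random graph. *)
Lemma copies_ratio_complete_ge k m d : k = m.*2.+1 -> (0 < m)%N -> (d + m <= 2 ^ m)%N ->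
  11 / 16 * (2 ^ 'C(d, 2))%:R * (1 - ((d + m) ^ 2)%:R / (2 ^ m)%:R)
    <= copies_ratio R k (complete_graph (d + m)).
Proof.
move=> kE m_gt0 s_le; set s := (d + m)%N in s_le *.
pose a i := (if i < m then 2 ^ (k - 1 - i) - 2 ^ i else 2 ^ m - 1 - i)%N.
have emb_ge : (\prod_(i < s) a i
    <= #|embeddings (odd_vector_graph k) (complete_graph s)|)%N.
  apply: leq_trans (card_embeddings_complete_ge d kE).
  rewrite /s addnC big_split_ord /=; apply/eq_leq; congr muln.
    by apply: eq_bigr => i _; rewrite /a ltn_ord.
  by apply: eq_bigr => i _; rewrite /a ltnNge leq_addr.
apply: le_trans (copies_ratio_ge R emb_ge).
rewrite (prod_split (fun i => (a i * 2 ^ i)%:R / (order_of k - i)%:R)).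
have kN : (2 ^ (k - 1) = 4 ^ m)%N.
  by rewrite kE subn1 /= -mul2n expnM.
set M : R := (2 ^ m)%:R; have M_gt0 : 0 < M by rewrite ltr0n expn_gt0.
have NM : (4 ^ m)%:R = M * M by rewrite -natrM -expnMn.
have MN : (2 ^ m < 4 ^ m)%N by rewrite ltn_exp2r.
have m_lt : (m < 2 ^ m)%N by exact: ltn_expl.
have n_gt i : (i < 2 ^ m)%N -> (0 < order_of k - i <= 4 ^ m)%N.
  by rewrite /order_of kN; lia.
have first_ge : 11 / 16 <= \prod_(i < m) ((a i * 2 ^ i)%:R / (order_of k - i)%:R) :> R.
  apply: le_trans (_ : \prod_(i < m) (1 - (4 ^ i)%:R / (4 ^ m)%:R) <= _).
    apply: le_trans (prod_quarters_ge m_gt0).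
    by rewrite lerDl divr_ge0 // invr_ge0 ler0n.
  apply: ler_prod => i _; have i_lt := ltn_ord i.
  have four_le : (4 ^ i <= 4 ^ m)%N by rewrite leq_exp2l // ltnW.
  have four_gt0 : 0 < (4 ^ m)%:R :> R by rewrite ltr0n expn_gt0.
  rewrite subr_ge0 ler_pdivrMr // mul1r ler_nat four_le /=.
  have aE : ((a i) * 2 ^ i = 4 ^ m - 4 ^ i)%N.
    rewrite /a i_lt mulnBl -!expnD -kN.
    have -> : (k - 1 - i + i = k - 1)%N by lia.
    by rewrite addnn -mul2n expnM.
  have /andP[] := n_gt i (ltn_trans i_lt m_lt).
  rewrite aE natrB // -(ltr0n R) -(ler_nat R).
  move: (order_of k - i)%:R => D D_gt0 D_le.
  have -> : 1 - (4 ^ i)%:R / (4 ^ m)%:R = ((4 ^ m)%:R - (4 ^ i)%:R) / (4 ^ m)%:R :> R.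
    by rewrite mulrBl divff // gt_eqF.
  by rewrite ler_wpM2l ?subr_ge0 ?ler_nat // lef_pV2.
have s_M : s%:R <= M by rewrite ler_nat.
have sM_ge0 : 0 <= s%:R / M :> R by rewrite divr_ge0 // ltW.
have sM_le1 : s%:R / M <= 1 by rewrite ler_pdivrMr // mul1r.
have second_ge : (2 ^ 'C(d, 2))%:R * (1 - (s ^ 2)%:R / M)
    <= \prod_(i < d) ((a (m + i) * 2 ^ (m + i))%:R / (order_of k - (m + i))%:R) :> R.
  apply: le_trans (_ : \prod_(i < d) ((2 ^ i)%:R * (1 - s%:R / M)) <= _).
    rewrite big_split /= -natr_prod -pow2_binomial ler_wpM2l ?ler0n //.
    apply: le_trans (@prod_ge_1subr R d (fun=> 1 - s%:R / M) (fun=> s%:R / M) _).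
      rewrite sumr_const card_ord -[_ *+ d]mulr_natr lerB // expnS expn1 natrM mulrAC.
      by rewrite ler_wpM2r ?invr_ge0 ?(ltW M_gt0) // ler_wpM2l // ler_nat leq_addr.
    by move=> i _; split; rewrite ?subr_ge0.
  apply: ler_prod => i _; have i_lt := ltn_ord i.
  have ri_lt : (m + i < s)%N by rewrite /s addnC ltn_add2r.
  rewrite mulr_ge0 ?ler0n ?subr_ge0 //=.
  have /andP[] := n_gt (m + i)%N (leq_trans ri_lt s_le).
  rewrite -(ltr0n R) -(ler_nat R); move: (order_of k - (m + i))%:R => D D_gt0 D_le.
  have a_ge : M - s%:R <= (a (m + i)%N)%:R.
    by rewrite /a ltnNge leq_addr /= lerBlDr -natrD ler_nat; lia.
  rewrite natrM expnD natrM -/M ler_pdivlMr //.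
  have -> : (2 ^ i)%:R * (1 - s%:R / M) * D = (2 ^ i)%:R * ((M - s%:R) * (D / M)).
    by field; rewrite gt_eqF.
  rewrite [leRHS](_ : _ = (2 ^ i)%:R * ((a (m + i)%N)%:R * M)); last by ring.
  rewrite ler_wpM2l ?ler0n // ler_pM ?subr_ge0 //; first by rewrite divr_ge0 // ltW.
  by rewrite ler_pdivrMr // -NM.
have P1_ge0 : 0 <= \prod_(i < m) ((a i * 2 ^ i)%:R / (order_of k - i)%:R) :> R.
  by apply: prodr_ge0 => i _; rewrite divr_ge0.
have P2_ge0 : 0 <= \prod_(i < d) ((a (m + i) * 2 ^ (m + i))%:R
    / (order_of k - (m + i))%:R) :> R.
  by apply: prodr_ge0 => i _; rewrite divr_ge0.
rewrite -mulrA; apply: le_trans (ler_wpM2r P2_ge0 first_ge).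
by rewrite ler_wpM2l.
Qed.
End CliqueNumerics.

(** * Limits along odd k *)

Local Open Scope classical_set_scope.

Section Asymptotics.
Variable R : realType.

Lemma near_odd_oo (P : nat -> Prop) (K : nat) :
  (forall m, (K <= m)%N -> P m.*2.+1) -> \forall k \near odd_oo, P k.
Proof.
move=> KP; exists K.*2.+1 => // k /= Kk kodd.
have kE : k = k./2.*2.+1 by rewrite -[LHS]odd_double_half kodd.
by rewrite kE; apply: KP; lia.
Qed.

Lemma ln2_gt0 : 0 < ln 2 :> R.
Proof. by rewrite ln_gt0 // ltr1n. Qed.

Lemma pow2_expR j : (2 ^ j)%:R = expR (j%:R * ln 2) :> R.
Proof. by rewrite expRM_natl lnK ?posrE // natrX. Qed.

Lemma order_of_odd m : order_of m.*2.+1 = (2 ^ m.*2 - 1)%N.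
Proof. by rewrite /order_of subSS subn0. Qed.

Lemma order_of_gt0 m : (0 < m)%N -> (0 < order_of m.*2.+1)%N.
Proof.
case: m => // m _; rewrite order_of_odd subn_gt0 doubleS !expnS.
by have := expn_gt0 2 m.*2; lia.
Qed.

Lemma ln_order_ge m : (0 < m)%N -> (m.*2%:R - 1) * ln 2 <= ln (order_of m.*2.+1)%:R :> R.
Proof.
move=> m_gt0; have m2 : (0 < m.*2)%N by rewrite double_gt0.
have -> : m.*2%:R - 1 = (m.*2 - 1)%:R :> R by rewrite natrB.
rewrite -ler_expR -pow2_expR lnK ?posrE ?ltr0n ?order_of_gt0 // ler_nat order_of_odd.
rewrite -[in leqRHS](subnK m2) addn1 expnS mul2n -addnn.
by have := expn_gt0 2 (m.*2 - 1); lia.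
Qed.

Lemma ln_order_le m : (0 < m)%N -> ln (order_of m.*2.+1)%:R <= m.*2%:R * ln 2 :> R.
Proof.
move=> m_gt0; rewrite -ler_expR -pow2_expR lnK ?posrE ?ltr0n ?order_of_gt0 //.
by rewrite ler_nat order_of_odd leq_subr.
Qed.

Lemma near_ln_order (M : R) : \forall k \near odd_oo, M < ln (order_of k)%:R.
Proof.
apply: (@near_odd_oo _ (Num.truncn (M / ln 2)).+1) => m Km.
have m_gt0 : (0 < m)%N by apply: leq_trans Km.
apply: lt_le_trans (ln_order_ge m_gt0); rewrite -ltr_pdivrMr ?ln2_gt0 //.
apply: lt_le_trans (truncnS_gt _) _.
have m_ge1 : 1 <= m%:R :> R by rewrite ler1n.
rewrite -addnn natrD; apply: le_trans (_ : m%:R <= _); last lra.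
by rewrite ler_nat.
Qed.

(** The common form of the error terms, both for arbitrary and for empty graphs. *)
Lemma cvg0_of_ln_order_bound (c : R) (F : nat -> R) : 0 < c ->
  (\forall k \near odd_oo, 0 <= F k <= expR (4 * (c / ln (order_of k)%:R)) - 1) ->
  F k @[k --> odd_oo] --> (0 : R).
Proof.
move=> c_gt0 Fbound; apply/cvgrPdist_le => e e_gt0.
have ln1e_gt0 : 0 < ln (1 + e) by rewrite ln_gt0 // ltrDl.
near=> k.
have /andP[F_ge0 F_le] : 0 <= F k <= expR (4 * (c / ln (order_of k)%:R)) - 1 by near: k.
have ln_gt : 4 * c / ln (1 + e) < ln (order_of k)%:R by near: k; apply: near_ln_order.
have ln_pos : 0 < ln (order_of k)%:R :> R.
  by apply: le_lt_trans ln_gt; rewrite divr_ge0 ?mulr_ge0 ?(ltW c_gt0) ?(ltW ln1e_gt0).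
rewrite sub0r normrN ger0_norm //; apply: le_trans F_le _.
rewrite lerBlDl -[leRHS]lnK ?posrE; last lra.
rewrite ler_expR mulrA ler_pdivrMr // [leRHS]mulrC -ler_pdivrMr //; exact: ltW.
Unshelve. all: by end_near.
Qed.

Lemma max_upto_ge0 (x : R) (F : nat -> R) : 0 <= max_upto x F.
Proof. exact: bigmax_ge_id. Qed.

Lemma max_upto_le (x e : R) (F : nat -> R) : 0 <= e ->
  (forall s, (0 < s)%N -> s%:R <= x -> F s <= e) -> max_upto x F <= e.
Proof.
move=> e_ge0 Fe; rewrite /max_upto big_nat_cond; apply: bigmax_le => // -[//|s].
by rewrite andbT => /andP[_]; rewrite ltnS truncn_gt_nat; apply: Fe.
Qed.

Lemma expR_bound_ge0 (x : R) : 0 <= x -> 0 <= expR (4 * x) - 1.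
Proof. by move=> x_ge0; have := expR_ge1Dx (4 * x); lra. Qed.

Lemma copies_ratio_close_ln k s c (C : R) (H : sgraph 'I_s) :
  (0 < order_of k)%N -> 0 < C -> C <= ln (order_of k)%:R ->
  (2 ^ (c + s))%:R <= (order_of k)%:R * (C / ln (order_of k)%:R) ->
  (#|embeddings (odd_vector_graph k) H| <= \prod_(i < s) (2 ^ (k - 1 - i) + 2 ^ c))%N ->
  (\prod_(i < s) (2 ^ (k - 1 - i) - 2 ^ c) <= #|embeddings (odd_vector_graph k) H|)%N ->
  `|copies_ratio R k H - 1| <= expR (4 * (C / ln (order_of k)%:R)) - 1.
Proof.
move=> n_gt0 C_gt0 C_le pow_le emb_le emb_ge.
have ln_gt0 : 0 < ln (order_of k)%:R :> R by apply: lt_le_trans C_le.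
have Cln : C / ln (order_of k)%:R <= 1 by rewrite ler_pdivrMr // mul1r.
have Cln0 : 0 <= C / ln (order_of k)%:R by rewrite divr_ge0 // ltW.
have n_le : (order_of k <= 2 ^ (k - 1))%N by rewrite leq_subr.
have N_gt0 : 0 < (2 ^ (k - 1))%:R :> R by rewrite ltr0n expn_gt0.
have pow_N : (2 ^ (c + s))%:R <= (2 ^ (k - 1))%:R * (C / ln (order_of k)%:R).
  by apply: le_trans pow_le _; rewrite ler_wpM2r // ler_nat.
have pow_N' : (2 ^ (c + s) <= 2 ^ (k - 1))%N.
  by rewrite -(ler_nat R); apply: le_trans pow_N _; rewrite ler_piMr // ltW.
apply: le_trans (copies_ratio_close R pow_N' emb_le emb_ge) _.
rewrite lerD2r ler_expR -mulrA ler_wpM2l // ler_pdivrMr //.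
by rewrite mulrC.
Qed.

End Asymptotics.

(** * The four assertions *)

Section Parts.
Variable R : realType.

Lemma near_odd_order (M : R) : \forall k \near odd_oo,
  [/\ odd k, (0 < order_of k)%N & M < ln (order_of k)%:R].
Proof.
near=> k; have M_lt : Num.max M 0 < ln (order_of k)%:R by near: k; apply: near_ln_order.
move: M_lt; rewrite gt_max => /andP[-> ln_gt0]; split=> //.
  by near: k; apply: (@near_odd_oo _ 0) => m _; rewrite /= odd_double.
by rewrite lt0n; apply/eqP => n0; rewrite n0 ln0 // ltxx in ln_gt0.
Unshelve. all: by end_near.
Qed.

Lemma all_graphs_cvg :
  max_upto (log2 (order_of k)%:R / 2 - (2 * ln 2)^-1 * ln (ln (order_of k)%:R))
    (fun s => \big[Num.max/0]_(H : sgraph 'I_s) `|copies_ratio R k H - 1|)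
  @[k --> odd_oo] --> (0 : R).
Proof.
(* The bound on [s] says exactly that [4 ^ s <= n / ln n]. *)
apply: (cvg0_of_ln_order_bound ltr01).
apply: filterS (near_odd_order 1) => k [kodd n_gt0 ln_gt1].
rewrite max_upto_ge0 /=; have ln2_gt0 := ln2_gt0 R.
have ln_gt0 : 0 < ln (order_of k)%:R :> R by apply: lt_trans ln_gt1.
have bound_ge0 : 0 <= expR (4 * (1 / ln (order_of k)%:R)) - 1 :> R.
  by apply: expR_bound_ge0; rewrite divr_ge0 // ltW.
apply: max_upto_le => // s s_gt0 s_le; apply: bigmax_le => // H _.
apply: (@copies_ratio_close_ln R k s s) => //; first exact: ltW.
- rewrite pow2_expR -[X in X * (1 / _)]lnK ?posrE ?ltr0n //.
  rewrite -[X in _ * (1 / X)]lnK ?posrE // div1r -expRN -expRD ler_expR.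
  have two_ln2_ge0 : 0 <= 2 * ln 2 :> R by rewrite mulr_ge0 // ltW.
  have := ler_wpM2r two_ln2_ge0 s_le; rewrite /log2.
  have -> : (ln (order_of k)%:R / ln 2 / 2 - (2 * ln 2)^-1 * ln (ln (order_of k)%:R))
      * (2 * ln 2) = ln (order_of k)%:R - ln (ln (order_of k)%:R) :> R.
    by field; rewrite gt_eqF.
  by rewrite natrD => h; lra.
- apply: leq_trans (card_embeddings_le H kodd) _; apply: leq_prod => i _.
  by rewrite leq_add2l leq_exp2l // leq_subr.
- apply: leq_trans (card_embeddings_ge H kodd); apply: leq_prod => i _.
  by rewrite leq_sub2l // leq_exp2l // ltnW.
Qed.

Lemma empty_graphs_cvg (eta : R) : 0 < eta ->
  max_upto ((1 - eta) * log2 (order_of k)%:R)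
    (fun s => `|copies_ratio R k (empty_graph s) - 1|)
  @[k --> odd_oo] --> (0 : R).
Proof.
move=> eta_gt0; have etaV_gt0 : 0 < eta^-1 by rewrite invr_gt0.
(* Here [2 ^ s <= n exp (- eta ln n) <= n / (eta ln n)]. *)
apply: (cvg0_of_ln_order_bound etaV_gt0).
apply: filterS (near_odd_order eta^-1) => k [kodd n_gt0 ln_gt].
rewrite max_upto_ge0 /=; have ln2_gt0 := ln2_gt0 R.
have ln_gt0 : 0 < ln (order_of k)%:R :> R by apply: lt_trans ln_gt.
have bound_ge0 : 0 <= expR (4 * (eta^-1 / ln (order_of k)%:R)) - 1 :> R.
  by apply: expR_bound_ge0; rewrite divr_ge0 // ltW.
apply: max_upto_le => // s s_gt0 s_le.
apply: (@copies_ratio_close_ln R k s 0) => //; first exact: ltW.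
- have s_le' : s%:R * ln 2 <= ln (order_of k)%:R - eta * ln (order_of k)%:R.
    apply: le_trans (ler_wpM2r (ltW ln2_gt0) s_le) _.
    by rewrite /log2 mulrA divfK ?gt_eqF //; lra.
  rewrite add0n pow2_expR.
  apply: le_trans (_ : expR (ln (order_of k)%:R - eta * ln (order_of k)%:R) <= _).
    by rewrite ler_expR.
  rewrite expRD lnK ?posrE ?ltr0n // ler_wpM2l ?ler0n // expRN -invfM.
  rewrite lef_pV2 ?posrE ?expR_gt0 ?mulr_gt0 //.
  by apply: le_trans (expR_ge1Dx _); rewrite lerDr.
- by apply: leq_trans (card_embeddings_empty_le s kodd) _; apply: leq_prod => i _; rewrite leq_addr.
- by apply: leq_trans (card_embeddings_empty_ge s kodd); apply: leq_prod.
Qed.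

Lemma independence_number_log2 k : odd k -> (0 < order_of k)%N ->
  (independence_number (odd_vector_graph k))%:R = log2 ((order_of k)%:R + 1) + 1 :> R.
Proof.
move=> kodd n_gt0; have k_gt1 : (1 < k)%N.
  by case: k kodd n_gt0 => [|[|k]].
rewrite independence_number_odd_vector_graph // /log2 natr1 /order_of -addn1 subnK ?expn_gt0 //.
rewrite pow2_expR expRK mulfK ?gt_eqF ?ln2_gt0 // natr1 -addn1 subnK //; exact: ltnW.
Qed.

Lemma cube_le_pow2 m : (10 <= m)%N -> (m ^ 3 <= 2 ^ m)%N.
Proof.
elim: m => // m IHm; rewrite leq_eqVlt => /orP[/eqP <- //|m_ge].
rewrite (expnS 2 m); apply: leq_trans (leq_mul (leqnn 2) (IHm _)); last by lia.
have m_ge' : (10 <= m)%N by lia.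
have sq_ge : (10 * m <= m * m)%N by rewrite leq_mul2r m_ge' orbT.
have cube_ge : (10 * (m * m) <= m * (m * m))%N by rewrite leq_mul2r m_ge' orbT.
rewrite !expnS !expn0; lia.
Qed.

(** Clique sizes are linear in [m], so this makes [s ^ 2 / 2 ^ m] small. *)
Lemma near_odd_sq_le_pow2 (a : R) : \forall k \near odd_oo,
  exists2 m, k = m.*2.+1 & [/\ (0 < m)%N, a <= m%:R & a * m%:R ^+ 2 <= (2 ^ m)%:R].
Proof.
apply: (@near_odd_oo _ (10 + (Num.truncn a).+1)) => m m_ge; exists m => //.
have a_le : a <= m%:R.
  by apply: le_trans (ltW (truncnS_gt a)) _; rewrite ler_nat (leq_trans (leq_addl _ _) m_ge).
have m_ge10 : (10 <= m)%N := leq_trans (leq_addr _ _) m_ge.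
split=> //; first exact: leq_trans m_ge10.
apply: le_trans (_ : m%:R * m%:R ^+ 2 <= _).
  by rewrite ler_wpM2r // exprn_ge0.
by rewrite -exprS -natrX ler_nat cube_le_pow2.
Qed.

Lemma binom2_nat d : binom2 d%:R = 'C(d, 2)%:R :> R.
Proof.
rewrite /binom2; case: d => [|d]; first by rewrite bin0n !mul0r.
have -> : d.+1%:R - 1 = d%:R :> R by rewrite -natr1 addrK.
rewrite -natrM; apply: (mulIf (_ : 2 != 0)); rewrite ?pnatr_eq0 // divfK ?pnatr_eq0 //.
by rewrite -natrM bin2 muln2 -[(_ * _)%N]odd_double_half oddM /= andNb add0n doubleK.
Qed.

(** Since [log2 n] is slightly less than [2 m], the exponent [x] is slightly more than the
    integer [d = s - m].  The difference costs at most a factor [exp q] with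
    [q = s ^ 2 / 2 ^ m <= 1 / 24], and there is room for it between [exp (- 2 / 3)]
    and 11/16. *)
Lemma complete_ratio_ge m s (x : R) : (0 < m)%N -> (m <= s)%N ->
  24 * s%:R ^+ 2 <= (2 ^ m)%:R :> R ->
  s%:R = x + log2 (order_of m.*2.+1)%:R / 2 -> 
  expR (- (2 / 3)) * 2 `^ binom2 x <= copies_ratio R m.*2.+1 (complete_graph s).
Proof.
move=> m_gt0 ms s_le sE.
have ln2_gt0 := ln2_gt0 R.
set n := order_of _ in sE *; have n_gt0 : (0 < n)%N := order_of_gt0 m_gt0.
set M : R := (2 ^ m)%:R in s_le; have M_gt0 : 0 < M by rewrite ltr0n expn_gt0.
set q := s%:R ^+ 2 / M; have q_ge0 : 0 <= q by rewrite divr_ge0 ?exprn_ge0 // ltW.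
have q_le : q <= 24^-1 by rewrite ler_pdivrMr // -ler_pdivrMl //; lra.
have s_ge1 : 1 <= s%:R :> R by rewrite ler1n; apply: leq_trans ms.
have sM : (s <= 2 ^ m)%N by rewrite -(ler_nat R) -/M; nra.
pose d := (s - m)%N; have sd : s = (d + m)%N by rewrite /d subnK.
have ratio_ge : 11 / 16 * 2 `^ 'C(d, 2)%:R * (1 - q) <= copies_ratio R m.*2.+1 (complete_graph s).
  have := @copies_ratio_complete_ge R _ m d erefl m_gt0.
  by rewrite -sd => /(_ sM); rewrite powR_mulrn ?ler0n // -natrX /q -natrX.
apply: le_trans ratio_ge.
have lnN : ln n%:R <= m.*2%:R * ln 2 :> R := ln_order_le R m_gt0.
have M_ge2 : 2 <= M by rewrite ler_nat -[2%N]expn1 leq_exp2l.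
have n_real_gt0 : 0 < n%:R :> R by rewrite ltr0n.
have nM : n%:R + 1 = M * M.
  by rewrite natr1 /n order_of_odd -addn1 subnK ?expn_gt0 // -addnn expnD natrM.
have delta_le : m.*2%:R * ln 2 - ln n%:R <= M^-1.
  have -> : m.*2%:R * ln 2 = ln (n%:R + 1) :> R.
    by rewrite nM -natrM -expnD addnn pow2_expR expRK.
  rewrite -ln_div ?posrE ?addr_gt0 // mulrDl divff ?gt_eqF // mul1r.
  apply: le_trans (le_ln1Dx _) _; first by apply: lt_trans (_ : 0 < _); rewrite ?invr_gt0 // ltrN10.
  by rewrite lef_pV2 ?posrE //; nra.
have binom_le : binom2 x * ln 2 <= 'C(d, 2)%:R * ln 2 + q.
  rewrite -binom2_nat; set D : R := d%:R.
  have DE : D = s%:R - m%:R by rewrite sd natrD addrK.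
  have x_le : x <= s%:R.
    rewrite sE lerDl divr_ge0 // /log2 divr_ge0 ?(ltW ln2_gt0) //.
    by rewrite ln_ge0 // ler1n.
  have D_le : D <= s%:R by rewrite DE lerBlDr lerDl.
  pose t := (x - D) * ln 2.
  have tE : t = (m.*2%:R * ln 2 - ln n%:R) / 2.
    rewrite /t DE; have -> : x = s%:R - log2 n%:R / 2 by lra.
    by rewrite /log2 -muln2 natrM; field; rewrite gt_eqF.
  have t_ge0 : 0 <= t by rewrite tE; lra.
  have t_le : t <= M^-1 by lra.
  have -> : binom2 x * ln 2 = binom2 D * ln 2 + t * ((x + D - 1) / 2).
    by rewrite /t /binom2; field.
  rewrite lerD2l; apply: le_trans (_ : t * s%:R <= _); first by rewrite ler_wpM2l //; lra.
  apply: le_trans (_ : M^-1 * s%:R <= _); first by rewrite ler_wpM2r.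
  by rewrite /q mulrC ler_wpM2r ?invr_ge0 ?(ltW M_gt0) // expr2 ler_peMr.
have pow_le : 2 `^ binom2 x <= 2 `^ 'C(d, 2)%:R * expR q.
  rewrite /powR pnatr_eq0 /= -expRD ler_expR; exact: binom_le.
apply: le_trans (ler_wpM2l (expR_ge0 _) pow_le) _.
have key : expR (- (2 / 3)) * expR q <= 11 / 16 * (1 - q).
  rewrite -expRD; have -> : - (2 / 3) + q = - (2 / 3 - q) by lra.
  rewrite expRN; apply: le_trans (_ : (1 + (2 / 3 - q))^-1 <= _).
    by rewrite lef_pV2 ?posrE ?expR_gt0 ?expR_ge1Dx //; lra.
  by rewrite -div1r ler_pdivrMr; nra.
have := ler_wpM2l (powR_ge0 2 'C(d, 2)%:R) key.
by rewrite mulrCA [X in _ <= X -> _]mulrCA mulrA => /le_trans; apply; rewrite mulrA.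
Qed.

End Parts.

Lemma complete_graphs_near (R : realType) (eta : R) : 0 < eta ->
  \forall k \near odd_oo, forall (s : nat) (eta' : R),
    let L : R := log2 (order_of k)%:R in
    `|s%:R - (2^-1 + eta) * L| < 1 -> s%:R = (2^-1 + eta') * L ->
    copies_ratio R k (complete_graph s) >= expR (- (2 / 3)) * 2 `^ binom2 (eta' * L).
Proof.
move=> eta_gt0; set a := 24 * (2 + 2 * eta) ^+ 2 + 1 / eta + 1.
have etaV_gt0 : 0 < 1 / eta by rewrite divr_gt0.
apply: filterS (near_odd_sq_le_pow2 a) => k [m -> [m_gt0 a_le sq_le]] s eta' s_near sE.
set L := log2 _ in s_near sE *.
have ln2_gt0 := ln2_gt0 R.
have m_ge1 : 1 <= m%:R :> R by rewrite ler1n.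
have L_le : L <= 2 * m%:R.
  rewrite /L /log2 ler_pdivrMr // -natrM mul2n; exact: ln_order_le.
have L_ge : 2 * m%:R - 1 <= L.
  rewrite /L /log2 ler_pdivlMr // -natrM mul2n; exact: ln_order_ge.
have etaE : 1 / eta * eta = 1 by rewrite mul1r mulVf // gt_eqF.
move: s_near; rewrite ltr_norml => /andP[s_gt s_lt].
have eta_m : 1 + eta <= eta * m%:R.
  have : eta * (1 / eta + 1) <= eta * m%:R.
    rewrite ler_wpM2l ?(ltW eta_gt0) //; apply: le_trans a_le; rewrite /a.
    have := exprn_even_ge0 (2 + 2 * eta) (isT : ~~ odd 2); lra.
  by rewrite mulrDr mulr1 mulrC etaE.
(* Sizes within 1 of [(1/2 + eta) L] are at least [m], as [L >= 2 m - 1]. *)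
have etaL : 2 + eta <= eta * L by nra.
have m_le : (m <= s)%N by rewrite -ltnS -(ltr_nat R) -natr1; lra.
have s_le : s%:R <= (2 + 2 * eta) * m%:R by nra.
have sq : 24 * s%:R ^+ 2 <= (2 ^ m)%:R :> R.
  apply: le_trans sq_le; apply: le_trans (_ : 24 * ((2 + 2 * eta) * m%:R) ^+ 2 <= _).
    by rewrite ler_wpM2l // lerXn2r ?nnegrE //; nra.
  rewrite exprMn mulrA ler_wpM2r ?exprn_ge0 // /a; lra.
apply: complete_ratio_ge => //.
by rewrite sE -/L; lra.
Qed.

Theorem theorem2p14 (R : realType) :
  (exists C : R,
     max_upto (log2 (order_of k)%:R / 2 - C * ln (ln (order_of k)%:R))
       (fun s => \big[Num.max/0]_(H : sgraph 'I_s) `|copies_ratio R k H - 1|)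
     @[k --> odd_oo] --> (0 : R))
  /\
  ((forall eta : R, 0 < eta ->
     max_upto ((1 - eta) * log2 (order_of k)%:R)
       (fun s => `|copies_ratio R k (empty_graph s) - 1|)
     @[k --> odd_oo] --> (0 : R))
   /\
   (forall k : nat, odd k -> (0 < order_of k)%N ->
     (independence_number (odd_vector_graph k))%:R
       = log2 ((order_of k)%:R + 1) + 1 :> R))
  /\
  (forall eta : R, 0 < eta -> \forall k \near odd_oo,
     let L : R := log2 (order_of k)%:R in
     (forall s : nat, s%:Z = Num.ceil ((2^-1 + eta) * L) ->
        copies_ratio R k (complete_graph s)
          >= expR (- (2 / 3)) * 2 `^ binom2 (eta * L))
     /\
     (forall (s : nat) (eta' : R),
        `|s%:R - (2^-1 + eta) * L| < 1 -> s%:R = (2^-1 + eta') * L ->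
        copies_ratio R k (complete_graph s)
          >= expR (- (2 / 3)) * 2 `^ binom2 (eta' * L))).
Proof.
split; first by exists (2 * ln 2)^-1; apply: all_graphs_cvg.
split; first by split; [exact: empty_graphs_cvg|exact: independence_number_log2].
move=> eta eta_gt0.
apply: filterS2 (complete_graphs_near eta_gt0) (near_ln_order (1 / eta * ln 2)) => k step ln_gt.
split=> // s; set L := log2 _ in step *; set x := (2^-1 + eta) * L => s_ceil.
have etaL : 1 <= eta * L.
  move: ln_gt.
  rewrite -ltr_pdivlMr ?ln2_gt0 // -/(log2 _) -/L => /ltW.
  by rewrite ler_pdivrMr // mulrC.
have L_gt0 : 0 < L by rewrite -(pmulr_rgt0 _ eta_gt0); apply: lt_le_trans etaL.
have sx : s%:R = (Num.ceil x)%:~R :> R by rewrite -s_ceil.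
have s_ge : x <= s%:R by rewrite sx ceil_ge.
have s_lt : s%:R < x + 1 by have := ceilB1_lt x; rewrite sx intrB; lra.
have s_near : `|s%:R - x| < 1 by rewrite ger0_norm ?subr_ge0 //; lra.
(* The ceiling is an instance of the integer case, with a parameter that is at least
   [eta]; [binom2] increases beyond 1/2. *)
have s_eq : s%:R = (2^-1 + (s%:R / L - 2^-1)) * L.
  by rewrite addrC subrK divfK // gt_eqF.
apply: le_trans (step _ _ s_near s_eq); rewrite ler_wpM2l ?expR_ge0 //.
rewrite ler_powR ?ler1n //.
have -> : (s%:R / L - 2^-1) * L = s%:R - 2^-1 * L by field; rewrite gt_eqF.
rewrite /binom2; have : eta * L <= s%:R - 2^-1 * L by move: s_ge; rewrite /x; lra.
by move: (s%:R - _) => y; nra.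
Qed.
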